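(* Let $Q=(Q_0,Q_1)$ be a finite connected quiver which has at least one loop, or which contains, at one of its vertices, a local $k$-generalized path Kronecker quiver for some $k\ge 2$. Let $n\ge 0$ be an integer and let $\beta=(n,n,\ldots,n)\in\mathbb{Z}_{\ge 0}^{Q_0}$. Impose the complete standard filtration of vector spaces at each vertex, let $F^{\bullet}Rep(Q,\beta)\cong\mathfrak{b}^{\oplus Q_1}$ be the corresponding filtered representation space, and let $\mathbb{U}=U^{\oplus Q_0}$ be the product over the vertices of the maximal unipotent subgroups $U\subseteq GL_n(\mathbb{C})$, acting on $F^{\bullet}Rep(Q,\beta)$ by change of basis. Then: (1) the vector space $F^{\bullet}Rep(Q,\beta)$ contains a point $p$ whose stabilizer in $\mathbb{U}$ is trivial, i.e. $\mathrm{Stab}_{\mathbb{U}}(p)$ consists only of the identity element $(\mathrm{I}_n)_{i\in Q_0}$; (2) $\dim_{\mathbb{C}} F^{\bullet}Rep(Q,\beta)/\!\!/\mathbb{U}=\dim_{\mathbb{C}}F^{\bullet}Rep(Q,\beta)-\dim_{\mathbb{C}}\mathbb{U}$.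
   Context: A quiver $Q=(Q_0,Q_1)$ is a directed graph with vertex set $Q_0$ and arrow set $Q_1$; each arrow $a$ has a tail $ta\in Q_0$ and a head $ha\in Q_0$. It is finite if $Q_0$ and $Q_1$ are finite, and connected if its underlying graph is connected. A loop is an arrow $a$ with $ta=ha$. A nontrivial path is a sequence $a_k\cdots a_2a_1$ ($k\ge 1$) of arrows with $t(a_{j+1})=h(a_j)$ for all $1\le j\le k-1$; it goes from $t(a_1)$ to $h(a_k)$. A cycle is a nontrivial path whose head equals its tail. A local $k$-generalized path Kronecker quiver of $Q$ (at a vertex $i$) is a subquiver consisting of $i$, a second vertex $j\neq i$, and $k$ pairwise distinct nontrivial paths between them, $m$ of them going from $i$ to $j$ and $m'$ of them going from $j$ to $i$, with $m+m'=k$, such that none of these paths contains a cycle. $\mathfrak{b}$ denotes the space of upper triangular $n\times n$ complex matrices, and $U$ the group of upper triangular $n\times n$ complex matrices with all diagonal entries equal to $1$. The complete standard filtration of $\mathbb{C}^n$ is $0\subseteq\mathbb{C}^1\subseteq\cdots\subseteq\mathbb{C}^n$, where $\mathbb{C}^j$ is the span of the first $j$ standard basis vectors. $F^{\bullet}Rep(Q,\beta)$ is the subspace of $Rep(Q,\beta)=\bigoplus_{a\in Q_1}\mathrm{Hom}_{\mathbb{C}}(\mathbb{C}^n,\mathbb{C}^n)$ of all tuples $W=(W(a))_{a\in Q_1}$ such that each $W(a)$ maps $\mathbb{C}^j$ into $\mathbb{C}^j$ for all $j$; thus it is identified with $\mathfrak{b}^{\oplus Q_1}$. The group $\mathbb{U}=U^{\oplus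 Q_0}$ acts by $(u^{(i)})_{i\in Q_0}\cdot(W(a))_{a\in Q_1}=\big(u^{(ha)}W(a)(u^{(ta)})^{-1}\big)_{a\in Q_1}$. The quotient is $F^{\bullet}Rep(Q,\beta)/\!\!/\mathbb{U}:=\mathrm{Spec}\big(\mathbb{C}[F^{\bullet}Rep(Q,\beta)]^{\mathbb{U}}\big)$. *)

(* Defs.v *)
From HB Require Import structures.
From mathcomp Require Import all_boot all_order all_algebra.
From mathcomp Require Import ring_quotient.
From mathcomp Require Import boolp classical_sets functions reals.

Set Implicit Arguments.
Unset Strict Implicit.
Unset Printing Implicit Defensive.

Import GRing.Theory.
Local Open Scope ring_scope.

Record quiver := Quiver {
  vertex : finType;
  arrow : finType;
  tail : arrow -> vertex;
  head : arrow -> vertex }.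

Section Quivers.
Variable Q : quiver.
Implicit Types (a b : arrow Q) (p : seq (arrow Q)) (i j : vertex Q).

Definition adjacent : rel (vertex Q) := fun i j =>
  [exists a, (tail a == i) && (head a == j) || (tail a == j) && (head a == i)].

Definition connected_quiver : Prop := forall i j, connect adjacent i j.

Definition has_loop : Prop := exists a, tail a = head a.

(* Paths are listed in the order in which they are travelled: the path
   [a_k ... a_2 a_1] is the sequence [:: a_1; a_2; ...; a_k]. *)
Definition is_path p : bool :=
  if p is a :: p' then path (fun b c => tail c == head b) a p' else false.

Definition path_from_to i j p : bool :=
  if p is a :: p' then
    [&& is_path p, tail a == i & head (last a p') == j]
  else false.

Definition is_cycle p : Prop := exists i, path_from_to i i p.

Definition contains_cycle p : Prop := exists2 c, infix c p & is_cycle c.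

Definition local_path_kronecker (i : vertex Q) (k : nat) : Prop :=
  exists (j : vertex Q) (m m' : nat) (s s' : seq (seq (arrow Q))),
    [/\ j != i, (m + m' = k)%N, size s = m, size s' = m' & uniq (s ++ s')] /\
    [/\ forall p, p \in s -> path_from_to i j p,
        forall p, p \in s' -> path_from_to j i p &
        forall p, p \in s ++ s' -> ~ contains_cycle p].

End Quivers.

Inductive polynomial_function (K : fieldType) (V : vectType K) :
    (V -> K) -> Prop :=
| PolyConst (c : K) : polynomial_function (fun=> c)
| PolyLin (l : {scalar V}) : polynomial_function l
| PolyAdd f g : polynomial_function f -> polynomial_function g ->
    polynomial_function (fun v => f v + g v)
| PolyMul f g : polynomial_function f -> polynomial_function g ->
    polynomial_function (fun v => f v * g v).

(* [X] is a variety given by its set of closed points, together with an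
   embedding [iota] of these points into an affine space [V].  The field being
   infinite in the applications, the coordinate ring of [X] is the ring of
   restrictions to [X] of polynomial functions on [V]. *)
Section CoordinateRing.
Variables (K : fieldType) (V : vectType K) (X : pointedType) (iota : X -> V).

Definition regular : {pred X -> K} := fun f =>
  `[< exists2 P, polynomial_function P & forall x, f x = P (iota x) >].

Fact regular_subring : subring_closed regular.
Proof.
split.
- by apply/asboolP; exists (fun=> 1); [exact: PolyConst|].
- move=> f g /asboolP[P hP fP] /asboolP[S hS gS]; apply/asboolP.
  exists (fun v => P v + (-1) * S v).
    by apply: PolyAdd => //; apply: PolyMul => //; exact: PolyConst.
  by move=> x; rewrite mulN1r -fP -gS.
- move=> f g /asboolP[P hP fP] /asboolP[S hS gS]; apply/asboolP.
  exists (fun v => P v * S v); first exact: PolyMul.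
  by move=> x; rewrite -fP -gS.
Qed.

HB.instance Definition _ :=
  GRing.isSubringClosed.Build (X -> K) regular regular_subring.

Record coord_ring := CoordRing {
  coord_fun :> X -> K;
  coord_fun_regular : coord_fun \in regular }.

HB.instance Definition _ := [isSub for coord_fun].
HB.instance Definition _ := [Choice of coord_ring by <:].
HB.instance Definition _ := [SubChoice_isSubComNzRing of coord_ring by <:].

(* [G] stands for the closed points of the group, so invariance is tested
   pointwise. *)
Variables (G : Type) (action : G -> X -> X).

Definition invariant : {pred coord_ring} := fun f =>
  `[< forall g x, f (action g x) = f x >].

Fact invariant_subring : subring_closed invariant.
Proof.
split.
- exact/asboolP.
- move=> f h /asboolP fI /asboolP hI; apply/asboolP => g x.
  by rewrite /= -[LHS]/(f (action g x) - h (action g x)) fI hI.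
- move=> f h /asboolP fI /asboolP hI; apply/asboolP => g x.
  by rewrite /= -[LHS]/(f (action g x) * h (action g x)) fI hI.
Qed.

HB.instance Definition _ :=
  GRing.isSubringClosed.Build coord_ring invariant invariant_subring.

Record invariant_ring := InvariantRing {
  invariant_fun :> coord_ring;
  invariant_funP : invariant_fun \in invariant }.

HB.instance Definition _ := [isSub for invariant_fun].
HB.instance Definition _ := [Choice of invariant_ring by <:].
HB.instance Definition _ := [SubChoice_isSubComNzRing of invariant_ring by <:].

End CoordinateRing.

Definition Spec (A : comNzRingType) := prime_idealr A.

Definition prime_chain (A : comNzRingType) (c : nat -> Spec A) (l : nat) :=
  forall i, (i < l)%N ->
    {subset (c i : {pred A}) <= (c i.+1 : {pred A})} /\
    ~ {subset (c i.+1 : {pred A}) <= (c i : {pred A})}.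

(* [dim_Spec A d]: the Krull dimension of [A] is finite and equal to [d]. *)
Definition dim_Spec (A : comNzRingType) (d : nat) : Prop :=
  (exists c : nat -> Spec A, prime_chain c d) /\
  (forall (c : nat -> Spec A) l, prime_chain c l -> (l <= d)%N).

Section FilteredRep.
Variables (K : fieldType) (Q : quiver) (n : nat).

Definition std_flag (j : nat) : {vspace 'cV[K]_n} :=
  <<[seq (delta_mx i 0 : 'cV[K]_n)%R | i : 'I_n <- enum 'I_n & (i < j)%N]>>%VS.

Definition Rep := {ffun arrow Q -> 'M[K]_n}.

Definition eval_rep (a : arrow Q) (v : 'cV[K]_n) (W : Rep) : 'cV[K]_n :=
  W a *m v.

Fact eval_rep_linear a v : linear (eval_rep a v).
Proof.
by move=> c W W'; rewrite /eval_rep !ffunE mulmxDl scalemxAl.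
Qed.

HB.instance Definition _ a v := GRing.isLinear.Build K Rep 'cV[K]_n _
  (eval_rep a v) (eval_rep_linear a v).

(* The tuples [W] such that every [W a] maps the first [j] standard basis vectors
   into the [j]-th step of the flag, for all [j]; see [mem_filtered_rep]. *)
Definition filtered_rep : {vspace Rep} :=
  (\bigcap_(a : arrow Q) \bigcap_(j < n.+1) \bigcap_(i < n | (i < j)%N)
     (linfun (eval_rep a (delta_mx i 0%R)) @^-1: std_flag j))%VS.

Lemma mem_std_flag j (v : 'cV[K]_n) :
  reflect (forall i : 'I_n, (j <= i)%N -> v i 0 = 0) (v \in std_flag j).
Proof.
apply: (iffP idP) => [|v0].
  rewrite /std_flag; set s := [seq _ | _ <- _ & _] => vs i ji.
  rewrite (@coord_span _ _ _ (in_tuple s) v vs) summxE big1 // => k _.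
  rewrite mxE; have /mapP[l] := mem_nth 0 (ltn_ord k : (k < size s)%N).
  rewrite mem_filter => /andP[lj _] ->; rewrite mxE eqxx andbT.
  by case: eqP => [il|_]; [rewrite -il ltnNge ji in lj | rewrite mulr0].
rewrite [v]matrix_sum_delta rpred_sum // => i _; rewrite big_ord1.
have [ij|ji] := ltnP i j; last by rewrite v0 // scale0r rpred0.
apply/rpredZ/memv_span/mapP; exists i => //.
by rewrite mem_filter ij mem_enum.
Qed.

Lemma mem_filtered_rep (W : Rep) :
  reflect (forall a j v, (j <= n)%N -> v \in std_flag j ->
             W a *m v \in std_flag j)
          (W \in filtered_rep).
Proof.
rewrite memvE; apply: (iffP idP) => [WF a j v jn vj|WF].
  rewrite [v]matrix_sum_delta mulmx_sumr rpred_sum // => i _.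
  rewrite big_ord1 -scalemxAr.
  have [ij|ji] := ltnP i j; last first.
    by move/mem_std_flag: vj => -> //; rewrite scale0r rpred0.
  apply: rpredZ; move/subv_bigcapP: WF => /(_ a isT).
  move=> /subv_bigcapP/(_ (Ordinal (jn : (j < n.+1)%N)) isT).
  by move=> /subv_bigcapP/(_ i ij); rewrite -memvE -memv_preim lfunE.
apply/subv_bigcapP => a _; apply/subv_bigcapP => j _; apply/subv_bigcapP => i ij.
rewrite -memvE -memv_preim lfunE; apply: WF; first by rewrite -ltnS.
apply/memv_span/mapP; exists i => //.
by rewrite mem_filter ij mem_enum.
Qed.

Definition unitriangular : {pred 'M[K]_n} := fun A =>
  [forall i : 'I_n, forall j : 'I_n, (j < i)%N ==> (A i j == 0)] && [forall i, A i i == 1].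

Record unipotent := Unipotent {
  unipotent_mx :> 'M[K]_n;
  unipotent_mxP : unipotent_mx \in unitriangular }.

HB.instance Definition _ := [isSub for unipotent_mx].
HB.instance Definition _ := [Choice of unipotent by <:].

Fact unitriangular1 : 1%:M \in unitriangular.
Proof.
apply/andP; split; last by apply/forallP => i; rewrite mxE eqxx.
apply/forallP => i; apply/forallP => j; apply/implyP => ji.
rewrite mxE; have [ij|_] := eqVneq i j; last by rewrite mulr0n.
by rewrite ij ltnn in ji.
Qed.

Definition unipotent1 : unipotent := Unipotent unitriangular1.

Definition unipotent_group := {ffun vertex Q -> unipotent}.

Definition unipotent_group1 : unipotent_group := [ffun=> unipotent1].

HB.instance Definition _ := Choice.on unipotent_group.
HB.instance Definition _ := isPointed.Build unipotent_group unipotent_group1.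

Definition unipotent_tuple (u : unipotent_group) :
  {ffun vertex Q -> 'M[K]_n} := [ffun i => u i : 'M[K]_n].

Definition change_basis (u : unipotent_group) (W : Rep) : Rep :=
  [ffun a => u (head a) *m W a *m invmx (u (tail a))].

Lemma unipotent_unit (u : unipotent) : (u : 'M[K]_n) \in unitmx.
Proof.
case: u => A /= /andP[/forallP A0 /forallP A1].
rewrite unitmxE -det_tr det_trig.
  by rewrite big1 ?unitr1 // => i _; rewrite mxE; exact/eqP.
apply/is_trig_mxP => i j ij; rewrite mxE.
exact/eqP/(implyP (forallP (A0 j) i)).
Qed.

Lemma std_flag_unipotent (u : unipotent) j (v : 'cV[K]_n) :
  v \in std_flag j -> (u : 'M[K]_n) *m v \in std_flag j.
Proof.
case: u => A /= /andP[/forallP A0 /forallP A1] /mem_std_flag v0.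
apply/mem_std_flag => i ji; rewrite mxE big1 // => k _.
have [ki|ik] := ltnP k i.
  by rewrite (eqP (implyP (forallP (A0 i) k) ki)) mul0r.
by rewrite v0 ?mulr0 // (leq_trans ji).
Qed.

Lemma std_flag_unipotentV (u : unipotent) j (v : 'cV[K]_n) :
  v \in std_flag j -> invmx (u : 'M[K]_n) *m v \in std_flag j.
Proof.
have uU := unipotent_unit u; case: u uU => A /= /andP[/forallP A0 /forallP A1] AU.
set w := invmx A *m v => /mem_std_flag v0.
have vE : v = A *m w by rewrite mulKVmx.
apply/mem_std_flag => i; have [m] := ubnP (n - i).
elim: m i => // m IH i im ji; have := v0 i ji.
rewrite vE mxE (bigD1 i) //= (eqP (A1 i)) mul1r big1 ?addr0 // => k ki.
have [{}ki|ik] := ltnP k i.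
  by rewrite (eqP (implyP (forallP (A0 i) k) ki)) mul0r.
have {ki}ik : (i < k)%N by rewrite ltn_neqAle ik andbT eq_sym.
rewrite IH ?mulr0 ?(leq_trans ji) ?(ltnW ik) //.
by apply: leq_trans (_ : n - i <= m)%N; rewrite // ltn_sub2l.
Qed.

Fact change_basis_filtered u W :
  W \in filtered_rep -> change_basis u W \in filtered_rep.
Proof.
move=> /mem_filtered_rep WF; apply/mem_filtered_rep => a j v jn vj.
rewrite ffunE -!mulmxA; apply/std_flag_unipotent/WF => //.
exact: std_flag_unipotentV.
Qed.

Definition filtered_repType := subvs_of filtered_rep.

HB.instance Definition _ := Vector.on filtered_repType.
HB.instance Definition _ := isPointed.Build filtered_repType 0.

Definition filtered_action (u : unipotent_group) (W : filtered_repType) :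
    filtered_repType :=
  Subvs (change_basis_filtered u (subvsP W)).

Definition stabilizer (p : filtered_repType) : set unipotent_group :=
  [set u | filtered_action u p = p].

Definition filtered_rep_invariants : comNzRingType :=
  @invariant_ring K Rep filtered_repType vsval unipotent_group filtered_action.

Definition unipotent_coord_ring : comNzRingType := coord_ring unipotent_tuple.

End FilteredRep.

(* Main.v *)
From HB Require Import structures.
Require Import Defs.
From mathcomp Require Import all_boot all_order all_algebra.
From mathcomp Require Import ring_quotient.
From mathcomp Require Import boolp classical_sets functions reals complex.

Set Implicit Arguments.
Unset Strict Implicit.
Unset Printing Implicit Defensive.

(* Two acyclic parallel or antiparallel paths contain an arrow [a0] whose
   removal leaves [Q] connected, as does a loop. Choose a spanning tree
   avoiding [a0]; transporting along it a matrix of eigenvectors of the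
   monodromy of [a0] gives matrices [N v W], polynomial in [W], with [N v (u W)
   = u v N v W]. At a point [S] with all [S a] diagonal and all [N v S]
   invertible the stabilizer is trivial. Generic [W] are moved by [diag(N v W)
   (N v W)^-1] into the linear slice of the representations that are diagonal
   along the tree and [a0]; its dimension is [dim b^Q1 - dim U^Q0]. Invariants
   are determined by their restrictions to the slice, which are polynomials, so
   a chain of primes is no longer than the dimension of the slice. Conversely,
   up to nonvanishing factors every coordinate of the slice is the restriction
   of an invariant, namely of a diagonal entry of [W b] or an entry of [adj (N
   (head b) W) (W b) (N (tail b) W)], so the primes of invariants vanishing on
   a coordinate flag of the slice form a chain of that length. This does not
   need the invariant ring to be finitely generated. *)

Local Notation head := Defs.head.

(** * Quivers: an arrow that is not a bridge, and a spanning tree avoiding it *)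

Section QuiverCombinatorics.
Variable Q : quiver.
Implicit Types (a b : arrow Q) (p q : seq (arrow Q)) (i j r v : vertex Q).

(** Unlike [path_from_to] it admits the empty path, at [i == j], so that paths can be cut anywhere
    and recursed on. *)
Fixpoint walk i p j : bool :=
  if p is a :: p' then (tail a == i) && walk (head a) p' j else i == j.

Lemma walk_cons a p i j : path_from_to i j (a :: p) = walk i (a :: p) j.
Proof.
rewrite /path_from_to /= andbCA; congr (_ && _).
by elim: p a {i} => //= b p IH a; rewrite -IH andbA.
Qed.

Lemma walk_cat i p q j :
  walk i (p ++ q) j -> exists2 v, walk i p v & walk v q j.
Proof.
elim: p i => [|a p IH] i /=; first by exists i.
by case/andP=> -> /IH[v pv qv]; exists v.
Qed.

Lemma acyclic_walk i c p q p' :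
  ~ contains_cycle p -> p = q ++ c ++ p' -> walk i c i -> c = [::].
Proof.
case: c => // a c pN pE ac; case: pN; exists (a :: c).
  by rewrite pE; exact: infix_infix.
by exists i; rewrite walk_cons.
Qed.

Definition adjacent_off a0 : rel (vertex Q) := fun i j =>
  [exists a, (a != a0) &&
     ((tail a == i) && (head a == j) || (tail a == j) && (head a == i))].

Lemma connect_off_sym a0 : connect_sym (adjacent_off a0).
Proof.
apply: sym_connect_sym => i j; apply: eq_existsb => a; congr (_ && _).
exact: orbC.
Qed.

Lemma connect_off_arrow a0 a :
  a != a0 -> connect (adjacent_off a0) (tail a) (head a).
Proof.
by move=> aa0; apply/connect1/existsP; exists a; rewrite aa0 !eqxx.
Qed.

Lemma connect_off_walk a0 i p j :
  a0 \notin p -> walk i p j -> connect (adjacent_off a0) i j.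
Proof.
elim: p i => [|a p IH] i /=; first by move=> _ /eqP->.
rewrite inE negb_or eq_sym => /andP[aa0 ap] /andP[/eqP<-] /(IH _ ap).
exact/connect_trans/connect_off_arrow.
Qed.

(** If [a] occurred again in [p], the stretch from the first [a] up to the second would be a cycle
    at [i]. *)
Lemma acyclic_head a p i j :
  ~ contains_cycle (a :: p) -> walk i (a :: p) j -> a \notin p.
Proof.
move=> pN /= /andP[/eqP ai pj]; apply/negP => /splitPr pE.
case: pE pN pj => x y pN /walk_cat[v xv /= /andP[/eqP av _]].
have := @acyclic_walk i (a :: x) _ [::] (a :: y) pN erefl.
by rewrite /= ai eqxx -ai av => /(_ xv).
Qed.

(** Strip common initial arrows until the first arrows differ. The first arrow [a] of [p] then
    occurs neither later in [p] nor in [q], so following [p] from [head a] to [j] and then [q]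
    backwards to [i] bypasses [a]. *)
Lemma parallel_nonbridge p q i j :
  p <> q -> ~ contains_cycle p -> ~ contains_cycle q ->
  walk i p j -> walk i q j ->
  exists a, connect (adjacent_off a) (head a) (tail a).
Proof.
elim: p q i => [|a p IH] q i pq pN qN wp wq.
  (* If one path is empty, the other one is closed, hence empty too by acyclicity. *)
  case: pq; rewrite (@acyclic_walk i q _ [::] [::] qN) ?cats0 //.
  by rewrite -(eqP wp) in wq.
case: q => [|b q] in pq qN wq *.
  case: pq; rewrite (@acyclic_walk i (a :: p) _ [::] [::] pN) ?cats0 //.
  by rewrite -(eqP wq) in wp.
have sub c s : ~ contains_cycle (c :: s) -> ~ contains_cycle s.
  move=> cs [x xs xc]; apply: cs; exists x => //.
  by rewrite infix_consl xs orbT.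
have [ab|ab] := eqVneq a b.
  rewrite -{b}ab in qN pq wq; move: wp wq => /= /andP[_ wp] /andP[_ wq].
  apply: (IH q (head a)) => //; [by move=> pq'; case: pq; rewrite pq'| |].
    exact: sub pN.
  exact: sub qN.
exists a; have ap := acyclic_head pN wp.
have [ai wp'] : tail a = i /\ walk (head a) p j by case/andP: wp => /eqP.
apply: connect_trans (connect_off_walk ap wp') _.
rewrite connect_off_sym ai; apply: (connect_off_walk _ wq).
(* If [q] is [x], then [a], then [y], the walk [x] is closed at [i], hence empty, and [a] is the
   first arrow of [q]. *)
apply/negP => /splitPr bqE.
case E : _ / bqE => [x y]; have := qN; have := wq.
rewrite E => /walk_cat[v xv /= /andP[/eqP av _]] xN.
have := @acyclic_walk i x _ [::] (a :: y) xN erefl.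
rewrite -ai av -{1}av ai => /(_ xv) x0; move: E; rewrite x0 => -[ba _].
by rewrite ba eqxx in ab.
Qed.

(** The arrow [a] does not occur in [p], nor in [q]: from an occurrence of [a] on, [q] would be a
    closed walk at [i]. So [p] followed by [q] bypasses [a]. *)
Lemma antiparallel_nonbridge a p q i j :
  ~ contains_cycle (a :: p) -> ~ contains_cycle q ->
  walk i (a :: p) j -> walk j q i ->
  exists a, connect (adjacent_off a) (head a) (tail a).
Proof.
move=> pN qN wp wq; exists a; have ap := acyclic_head pN wp.
have [ai wp'] : tail a = i /\ walk (head a) p j by case/andP: wp => /eqP.
apply: connect_trans (connect_off_walk ap wp') _.
rewrite ai; apply: (connect_off_walk _ wq).
apply/negP => /splitPr qE.
case: qE qN wq => x y qN /walk_cat[v xv ayv].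
have vi : v = i by case/andP: ayv => /eqP <-.
rewrite vi in ayv.
by have := @acyclic_walk i (a :: y) _ x [::] qN; rewrite cats0 => /(_ erefl ayv).
Qed.

Lemma nonbridge_exists :
  has_loop Q \/ (exists i k, (2 <= k)%N /\ local_path_kronecker i k) ->
  exists a, connect (adjacent_off a) (head a) (tail a).
Proof.
case=> [[a ta]|[i [k [k2 [j [m [m' [s [s' [[_ mk sm sm' us] [sP s'P sN]]]]]]]]]]].
  by exists a; rewrite ta.
have pw x y p : path_from_to x y p -> walk x p y.
  by case: p => // a p; rewrite walk_cons.
have {k2 mk sm sm'} : (2 <= size (s ++ s'))%N by rewrite size_cat sm sm' mk.
(* According to whether [s] has no, one or more paths, there are two paths from [j] to [i], two in
   opposite directions, or two from [i] to [j]. *)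
case: s us sP sN => [|p [|q s]] us sP sN s2.
- case: s' s2 us s'P sN => [|p [|q s']] //= _ us s'P sN.
  apply: (@parallel_nonbridge p q j i).
  + by move=> pq; rewrite pq !inE eqxx in us.
  + by apply: sN; rewrite !inE eqxx.
  + by apply: sN; rewrite !inE eqxx orbT.
  + by apply/pw/s'P; rewrite !inE eqxx.
  + by apply/pw/s'P; rewrite !inE eqxx orbT.
- case: s' s2 us s'P sN => [|q s'] //= _ us s'P sN.
  have := sP p (mem_head _ _); case: p us sP sN => // a p us sP sN /pw ap.
  apply: (@antiparallel_nonbridge a p q i j) => //.
  + by apply: sN; rewrite !inE eqxx.
  + by apply: sN; rewrite !inE eqxx orbT.
  + by apply/pw/s'P; rewrite !inE eqxx.
- apply: (@parallel_nonbridge p q i j).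
  + by move=> pq; rewrite pq /= !inE eqxx in us.
  + by apply: sN; rewrite !inE eqxx.
  + by apply: sN; rewrite !inE eqxx orbT.
  + by apply/pw/sP; rewrite !inE eqxx.
  + by apply/pw/sP; rewrite !inE eqxx orbT.
Qed.

(** Every use of [a0] in a connecting chain is replaced by the bypass. *)
Lemma connected_off a0 : connected_quiver Q ->
  connect (adjacent_off a0) (head a0) (tail a0) ->
  forall i j, connect (adjacent_off a0) i j.
Proof.
move=> Qc a0c i j; apply: connect_sub (Qc i j) => {i j} i j /existsP[a].
have [->|aa0] := eqVneq a a0.
  case/orP=> /andP[/eqP<- /eqP<-]; first by rewrite connect_off_sym.
  exact: a0c.
by move=> aij; apply/connect1/existsP; exists a; rewrite aa0.
Qed.

(* A letter [(a, true)] travels [a] forwards, [(a, false)] backwards; the last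
   letter travelled is the head of the sequence, as in a product of matrices. *)
Fixpoint zigzag r (w : seq (arrow Q * bool)) v : bool :=
  match w with
  | [::] => v == r
  | (a, true) :: w' => (head a == v) && zigzag r w' (tail a)
  | (a, false) :: w' => (tail a == v) && zigzag r w' (head a)
  end.

(** The tree grows arrow by arrow: [C] holds the vertices reached, [T] the arrows chosen, [w v] a
    zigzag inside [T] from the root to [v]. By the last clause the words at the two ends of an arrow
    of [T] differ by that one letter, which makes transport along the words compatible with the
    arrow. *)
Lemma partial_spanning_tree a0 r m :
  (forall i j, connect (adjacent_off a0) i j) -> (m < #|vertex Q|)%N ->
  exists (C : {set vertex Q}) (T : {set arrow Q})
      (w : vertex Q -> seq (arrow Q * bool)),
    [/\ #|C| = m.+1, #|T| = m, r \in C & a0 \notin T] /\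
    [/\ forall a, a \in T -> (tail a \in C) && (head a \in C),
        forall v, v \in C -> zigzag r (w v) v,
        forall v, v \in C -> {subset unzip1 (w v) <= T} &
        forall a, a \in T -> w (head a) = (a, true) :: w (tail a) \/
                             w (tail a) = (a, false) :: w (head a)].
Proof.
move=> Qc; elim: m => [|m IH] mQ.
  exists (finset.set1 r), finset.set0, (fun=> [::]); split.
    by split; rewrite ?cards1 ?cards0 ?inE.
  by split=> // [a|v|a]; rewrite ?inE //=.
have [C [T [w [[Cm Tm rC a0T] [TC wz wT wE]]]]] := IH (ltnW mQ).
(* Otherwise [C] would be closed under adjacency off [a0] and so contain every vertex. *)
have [a [aa0 aC]] : exists a, a != a0 /\ (tail a \in C) != (head a \in C).
  apply: contrapT => /forallNP noa.
  have Ccl : closed (adjacent_off a0) (mem C).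
    move=> i j /existsP[a /andP[aa0 aij]]; apply/eqP; apply/negPn/negP => ijC.
    apply: (noa a); split=> //.
    by case/orP: aij => /andP[/eqP-> /eqP->] //; rewrite eq_sym.
  have : (#|vertex Q| <= #|C|)%N.
    apply/subset_leq_card/fintype.subsetP => v _.
    by rewrite -(closed_connect Ccl (Qc r v)).
  by rewrite Cm leqNgt mQ.
have aT : a \notin T by apply: contraNN aC => /TC/andP[-> ->].
(* [v] is the end of [a] outside [C], and [l.2] tells whether [a] is travelled forwards to reach
   it. *)
have [v [l [vC lC lw]]] : exists (v : vertex Q) (l : arrow Q * bool),
    [/\ v \notin C, l.1 = a &
    exists2 v', v' \in C &
      (l.2 /\ head a = v /\ tail a = v' \/ ~~ l.2 /\ tail a = v /\ head a = v')].
  case: (boolP (tail a \in C)) aC => tC; case: (boolP (head a \in C)) => hC // _.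
    exists (head a), (a, true); split=> //; exists (tail a) => //; by left.
  exists (tail a), (a, false); split=> //; exists (head a) => //; by right.
case: l lC lw => [_ fwd] /= _ [v' v'C lw].
pose w' x := if x == v then (a, fwd) :: w v' else w x.
have w'E x : x \in C -> w' x = w x.
  by rewrite /w'; case: eqP => // -> xC; rewrite xC in vC.
have w'v : w' v = (a, fwd) :: w v' by rewrite /w' eqxx.
exists (v |: C)%SET, (a |: T)%SET, w'; split.
  split; rewrite ?cardsU1 ?vC ?aT ?Cm ?Tm // !inE ?rC ?orbT //.
  by rewrite negb_or eq_sym aa0.
have aE : w' (head a) = (a, true) :: w' (tail a) \/
          w' (tail a) = (a, false) :: w' (head a).
  case: lw => -[fE [-> ->]]; [left|right];
  by rewrite w'v w'E //; case: (fwd) fE.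
split.
- move=> b; rewrite !inE => /predU1P[->|/TC/andP[-> ->]]; last by rewrite !orbT.
  by case: lw => -[_ [-> ->]]; rewrite v'C eqxx orbT.
- move=> x; rewrite !inE => /predU1P[->|xC]; last by rewrite w'E // wz.
  rewrite w'v /=.
  by case: lw => -[+ [-> ->]]; case: (fwd) => // _; rewrite eqxx wz.
- move=> x; rewrite !inE => /predU1P[->|xC] b.
    rewrite w'v inE => /predU1P[->|bw]; first by rewrite setU11.
    by rewrite inE (wT v') ?orbT.
  by rewrite w'E // => bw; rewrite inE (wT x) ?orbT.
- move=> b; rewrite !inE => /predU1P[->|bT] //.
  by have /andP[tC hC] := TC b bT; rewrite !w'E //; exact: wE.
Qed.

Lemma spanning_tree a0 r : (forall i j, connect (adjacent_off a0) i j) ->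
  exists (T : {set arrow Q}) (w : vertex Q -> seq (arrow Q * bool)),
    [/\ #|T|.+1 = #|vertex Q|, a0 \notin T, forall v, zigzag r (w v) v,
        forall v, {subset unzip1 (w v) <= T} &
        forall a, a \in T -> w (head a) = (a, true) :: w (tail a) \/
                             w (tail a) = (a, false) :: w (head a)].
Proof.
move=> Qc; have Q0 : (0 < #|vertex Q|)%N by apply/card_gt0P; exists r.
have [|C [T [w [[Cm Tm rC a0T] [TC wz wT wE]]]]] :=
  @partial_spanning_tree a0 r #|vertex Q|.-1 Qc.
  by rewrite prednK.
have CT v : v \in C.
  have /subset_cardP/(_ (fintype.subset_predT _)) -> // : #|C| = #|vertex Q|.
  by rewrite Cm prednK.
exists T, w; split=> // [|v|v]; first by rewrite Tm prednK.
  exact: wz.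
exact: wT.
Qed.

End QuiverCombinatorics.

Local Open Scope classical_set_scope.
Local Open Scope ring_scope.
Import Order.TTheory GRing.Theory Num.Theory.

(** * Krull dimension of rings of functions *)

Section IteratedPolynomials.
Variable K : fieldType.

(** Polynomials in [l] variables, the outermost one being number 0; the nesting permits induction on
    [l] through univariate polynomials. *)
Fixpoint ipoly (l : nat) : comNzRingType :=
  if l is l'.+1 then {poly ipoly l'} else K.

Fixpoint ieval (A : comNzRingType) (k : {rmorphism K -> A}) (l : nat)
    (x : nat -> A) : {rmorphism ipoly l -> A} :=
  match l return {rmorphism ipoly l -> A} with
  | 0 => k
  | l'.+1 => horner_morph
     ((fun=> mulrC _ _) : commr_rmorph (ieval k l' (fun i => x i.+1)) (x 0))
  end.

Fixpoint iconst (l : nat) : {rmorphism K -> ipoly l} :=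
  match l return {rmorphism K -> ipoly l} with
  | 0 => idfun
  | l'.+1 => polyC \o iconst l'
  end.

Fixpoint ivar (l k : nat) : ipoly l :=
  match l return ipoly l with
  | 0 => 0
  | l'.+1 => if k is k'.+1 then (ivar l' k')%:P else 'X
  end.

Section Evaluation.
Variables (A : comNzRingType) (k : {rmorphism K -> A}).

Lemma ievalX l x : ieval k l.+1 x 'X = x 0.
Proof. exact: horner_morphX. Qed.

Lemma ievalC l x (c : ipoly l) :
  ieval k l.+1 x c%:P = ieval k l (fun i => x i.+1) c.
Proof. exact: horner_morphC. Qed.

Lemma ieval_const l x c : ieval k l x (iconst l c) = k c.
Proof. by elim: l x => // l IH x; rewrite [iconst _ _]/= ievalC IH. Qed.

Lemma ieval_var l x i : (i < l)%N -> ieval k l x (ivar l i) = x i.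
Proof.
elim: l x i => // l IH x [|i] il; first exact: ievalX.
by rewrite [ivar _ _]/= ievalC IH.
Qed.

Lemma eq_ieval l x x' : (forall i, (i < l)%N -> x i = x' i) ->
  ieval k l x =1 ieval k l x'.
Proof.
elim: l x x' => // l IH x x' xx' P.
elim/(@poly_ind (ipoly l)): P => [|p c IHp]; first by rewrite !rmorph0.
rewrite !rmorphD !rmorphM /= !ievalX !ievalC IHp xx' //.
by rewrite (IH _ (fun i => x' i.+1)) // => i il; exact: xx'.
Qed.

End Evaluation.

Lemma ieval_morph (A B : comNzRingType) (k : {rmorphism K -> A})
    (k' : {rmorphism K -> B}) (f : {rmorphism A -> B}) :
  k' =1 f \o k ->
  forall l x P, f (ieval k l x P) = ieval k' l (f \o x) P.
Proof.
move=> kf; elim=> [|l IH] x P; first by rewrite /= kf.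
elim/(@poly_ind (ipoly l)): P => [|p c IHp]; first by rewrite !rmorph0.
by rewrite !(rmorphD, rmorphM) !ievalX !ievalC IHp IH.
Qed.

(* The lexicographically smallest monomial of [P] decides: modulo [c 1] only the
   part of [P] free of its first variable survives. *)
Lemma prime_chain_alg_indep (A : comNzRingType) (k : {rmorphism K -> A}) l
    (c : nat -> Spec A) (x : nat -> A) :
  prime_chain c l ->
  (forall i, (i < l)%N -> x i \in (c i.+1 : {pred A}) /\
                          x i \notin (c i : {pred A})) ->
  forall P : ipoly l, P != 0 -> ieval k l x P \notin (c 0 : {pred A}).
Proof.
elim: l c x => [|l IH] c x cP xP P P0.
  apply/negP => kP; have := idealr1 (c 0).
  by rewrite -(rmorph1 k) -(mulVf P0) rmorphM /= (idealMr _ kP).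
have IH' : forall P : ipoly l, P != 0 ->
    ieval k l (fun i => x i.+1) P \notin (c 1 : {pred A}).
  by apply: (IH (fun i => c i.+1)) => i il; [exact: cP | exact: xP].
have [x1 x0] := xP 0 isT; have [c01 _] := cP 0 isT.
elim/(@poly_ind (ipoly l)): P P0 => [|p a IHp]; first by rewrite eqxx.
have [-> | a0 _] := eqVneq a 0.
  rewrite addr0 => pX0; rewrite rmorphM /= ievalX prime_idealrM negb_or x0 andbT.
  by apply: IHp; apply: contraNneq pX0 => ->; rewrite mul0r.
apply: contra (IH' a a0) => /c01; rewrite rmorphD rmorphM /= ievalX ievalC.
move/rpredB => /(_ _ (idealMr (ieval k l.+1 x p) x1)).
by rewrite addrAC subrr add0r.
Qed.

(** Degree at most [D] in each variable separately, so that [D.+1 ^ l] coefficients determine the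
    polynomial. *)
Fixpoint box (D l : nat) : ipoly l -> Prop :=
  match l return ipoly l -> Prop with
  | 0 => fun=> True
  | l'.+1 => fun P => (size (P : {poly ipoly l'}) <= D.+1)%N /\
               forall i, box D (P : {poly ipoly l'})`_i
  end.

Lemma box0 D l : box D (0 : ipoly l).
Proof.
by elim: l => //= l IH; rewrite size_poly0; split=> // i; rewrite coef0.
Qed.

Lemma box_const D l c : box D (iconst l c).
Proof.
elim: l => //= l IH; split; first exact: leq_trans (size_polyC_leq1 _) _.
by move=> i; rewrite coefC; case: ifP => _; [exact: IH | exact: box0].
Qed.

Lemma boxD D l (P P' : ipoly l) : box D P -> box D P' -> box D (P + P').
Proof.
elim: l P P' => //= l IH P P' [sP bP] [sP' bP']; split.
  by rewrite (leq_trans (size_polyD _ _)) // geq_max sP.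
by move=> i; rewrite coefD; exact: IH.
Qed.

Lemma box_mono D D' l (P : ipoly l) : (D <= D')%N -> box D P -> box D' P.
Proof.
move=> DD'; elim: l P => //= l IH P [sP bP]; split=> [|i]; last exact: IH.
exact: leq_trans sP _.
Qed.

Lemma boxM D D' l (P P' : ipoly l) :
  box D P -> box D' P' -> box (D + D') (P * P').
Proof.
elim: l P P' => //= l IH P P' [sP bP] [sP' bP']; split.
  apply: leq_trans (size_polyMleq _ _) _.
  rewrite -subn1 leq_subLR (leq_trans (leq_add sP sP')) //.
  by rewrite addSn addnS add1n.
move=> i; rewrite coefM; apply: (big_ind (@box (D + D') l)).
- exact: box0.
- by move=> *; exact: boxD.
- by move=> j _; exact: IH.
Qed.

Lemma boxX D l (P : ipoly l) n : box D P -> box (D * n) (P ^+ n).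
Proof.
move=> bP; elim: n => [|n IH].
  by rewrite expr0 -(rmorph1 (iconst l)); exact: box_const.
by rewrite exprS mulnS; exact: boxM.
Qed.

Lemma box_exists l (P : ipoly l) : exists D, box D P.
Proof.
elim: l P => [|l IH] P; first by exists 0.
elim/(@poly_ind (ipoly l)): P => [|p c [D bp]]; first by exists 0; exact: box0.
have [D' bc] := IH c; exists (maxn (D + 1) D').
apply: boxD; last first.
  split; first exact: leq_trans (size_polyC_leq1 _) _.
  move=> i; rewrite coefC; case: ifP => _; last exact: box0.
  by apply: box_mono bc; exact: leq_maxr.
apply: (@box_mono (D + 1)); first exact: leq_maxl.
apply: (@boxM D 1 l.+1) => //; split; first by rewrite size_polyX.
move=> i; rewrite coefX -(rmorph_nat (iconst l)); exact: box_const.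
Qed.

(** Exponent vectors with entries below [N]. Below, [icoef] reads the coefficient at such a vector,
    [imk] assembles a polynomial from coefficients, and [xpow] is the monomial evaluated at [x]. *)
Fixpoint idx (N l : nat) : finType :=
  if l is l'.+1 then ('I_N * idx N l')%type else unit.

Lemma card_idx N l : #|idx N l| = (N ^ l)%N.
Proof.
elim: l => [|l IH]; first by rewrite card_unit.
by rewrite card_prod card_ord IH expnS.
Qed.

Fixpoint icoef (N l : nat) : ipoly l -> idx N l -> K :=
  match l return ipoly l -> idx N l -> K with
  | 0 => fun P _ => P
  | l'.+1 => fun P s => icoef (P : {poly ipoly l'})`_(s.1) s.2
  end.

Lemma icoefZD N l a (P P' : ipoly l) (s : idx N l) :
  icoef (iconst l a * P + P') s = a * icoef P s + icoef P' s.
Proof.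
by elim: l P P' s => //= l IH P P' s; rewrite coefD coefCM IH.
Qed.

Lemma icoef0 N l (s : idx N l) : icoef (0 : ipoly l) s = 0.
Proof. by elim: l s => //= l IH s; rewrite coef0 IH. Qed.

Lemma icoef_sum N l (I : finType) (a : I -> K) (P : I -> ipoly l)
    (s : idx N l) :
  icoef (\sum_i iconst l (a i) * P i) s = \sum_i a i * icoef (P i) s.
Proof.
elim/big_rec2: _ => [|i y1 y2 _ <-]; first by rewrite icoef0.
by rewrite icoefZD.
Qed.

Lemma box_icoef_eq0 D l (P : ipoly l) :
  box D P -> (forall s : idx D.+1 l, icoef P s = 0) -> P = 0.
Proof.
elim: l P => [|l IH] P /=; first by move=> _ /(_ tt).
move=> [sP bP] P0; apply/polyP => i; rewrite coef0.
have [iD|Di] := ltnP i D.+1; last by rewrite nth_default // (leq_trans sP).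
by apply: IH => // s; exact: (P0 (Ordinal iD, s)).
Qed.

Fixpoint imk (N l : nat) : (idx N l -> K) -> ipoly l :=
  match l return (idx N l -> K) -> ipoly l with
  | 0 => fun c => c tt
  | l'.+1 => fun c => \sum_(i < N) (imk (fun s => c (i, s)))%:P * 'X^i
  end.

Lemma icoef_imk N l (c : idx N l -> K) s : icoef (imk c) s = c s.
Proof.
elim: l c s => [|l IH] c s /=; first by case: s.
rewrite coef_sum (bigD1 s.1) //= coefCM coefXn eqxx mulr1.
rewrite big1 => [|i si]; first by rewrite addr0 IH -surjective_pairing.
rewrite coefCM coefXn; have -> : (s.1 == i :> nat) = false.
  by rewrite -val_eqE eq_sym in si; exact: negbTE si.
by rewrite mulr0.
Qed.

Fixpoint xpow (A : comNzRingType) (N l : nat) (x : nat -> A) :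
    idx N l -> A :=
  match l return idx N l -> A with
  | 0 => fun=> 1
  | l'.+1 => fun s => x 0 ^+ (s.1 : 'I_N) * xpow (fun i => x i.+1) s.2
  end.

Lemma ieval_imk (A : comNzRingType) (k : {rmorphism K -> A}) N l
    (c : idx N l -> K) x :
  ieval k l x (imk c) = \sum_s k (c s) * xpow x s.
Proof.
elim: l c x => [|l IH] c x.
  by rewrite (bigD1 tt) //= mulr1 big1 ?addr0 // => -[].
rewrite [imk _]/= rmorph_sum /=; under eq_bigr do
  rewrite rmorphM rmorphXn /= ievalX ievalC IH mulr_suml.
rewrite pair_bigA /=; apply: eq_bigr => -[i s] _ /=.
by rewrite -mulrA [xpow _ s * _]mulrC.
Qed.

Lemma box_xpow D N l d (x : nat -> ipoly d) (s : idx N l) :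
  (forall i, (i < l)%N -> box D (x i)) -> box (l * (D * N)) (xpow x s).
Proof.
elim: l x s => [|l IH] x s bx.
  by rewrite /= -(rmorph1 (iconst d)); exact: box_const.
rewrite mulSn; apply: boxM; last first.
  by apply: (IH (fun i => x i.+1)) => i; exact: (bx i.+1).
apply: (@box_mono (D * s.1)); first by rewrite leq_mul2l (ltnW (ltn_ord _)) orbT.
by apply: boxX; exact: bx.
Qed.

Lemma ker_row_exists m n (A : 'M[K]_(m, n)) : (n < m)%N ->
  exists2 v : 'rV_m, v != 0 & v *m A = 0.
Proof.
move=> nm; have /rowV0Pn[v /sub_kermxP vA v0] : kermx A != 0.
  rewrite -mxrank_eq0 mxrank_ker subn_eq0 -ltnNge.
  exact: leq_ltn_trans (rank_leq_col A) nm.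
by exists v.
Qed.

(* There are [N ^ d.+1] monomials with exponents below [N] in the [x i], but they lie
   in a space of polynomials of dimension [E.+1 ^ d] with [E] linear in [N]. *)
Lemma ipoly_alg_dep d (x : nat -> ipoly d) :
  exists2 Q : ipoly d.+1, Q != 0 & ieval (iconst d) d.+1 x Q = 0.
Proof.
have [D bx] : exists D, forall i, (i < d.+1)%N -> box D (x i).
  elim: d.+1 => [|m [D IH]]; first by exists 0.
  have [D' bm] := box_exists (x m); exists (maxn D D') => i.
  rewrite ltnS leq_eqVlt => /predU1P[->|im].
    by apply: box_mono bm; exact: leq_maxr.
  by apply: box_mono (IH i im); exact: leq_maxl.
(* A monomial in the [x i] with exponents below [N] has degree at most [E] in each variable, and
   [E.+1 <= C * N]. The count needs [C ^ d * N ^ d < N ^ d.+1], hence the choice of [N] just above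
   [C ^ d]. *)
pose C := (d.+1 * D).+1; pose N := (C ^ d).+1; pose E := (d.+1 * (D * N))%N.
have lt : (#|idx E.+1 d| < #|idx N d.+1|)%N.
  rewrite !card_idx expnS.
  apply: (@leq_ltn_trans ((C * N) ^ d)%N).
    have EC : (E.+1 <= C * N)%N.
      by rewrite /E /C mulnA [leqRHS]mulSn -[ltnLHS]add0n ltn_add2r.
    have [d0|d0] := posnP d; last by rewrite leq_exp2r.
    by rewrite [X in (_ ^ X <= _)%N]d0 [X in (_ <= _ ^ X)%N]d0.
  by rewrite expnMn ltn_pmul2r // expn_gt0.
pose A := \matrix_(i < #|idx N d.+1|, j < #|idx E.+1 d|)
  icoef (xpow x (enum_val i)) (enum_val j).
(* The rows of [A] are the coefficient vectors of the monomials; a linear relation between them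
   supplies the coefficients of the polynomial sought. *)
have [v v0 vA] := ker_row_exists A lt.
pose c s := v 0 (enum_rank s); exists (imk c).
  apply: contra_neq v0 => c0; apply/rowP => i; rewrite mxE.
  by rewrite -(enum_valK i) -[LHS]/(c _) -icoef_imk c0 icoef0.
rewrite ieval_imk; apply: (@box_icoef_eq0 E) => [|s].
  apply: (big_ind (@box E d)); [exact: box0|by move=> *; exact: boxD|].
  move=> s _; rewrite -[E]add0n; apply: boxM; first exact: box_const.
  exact: box_xpow.
rewrite icoef_sum.
transitivity ((v *m A) 0 (enum_rank s)); last by rewrite vA mxE.
rewrite mxE (reindex (@enum_val (idx N d.+1) xpredT)) /=; last first.
  by apply: onW_bij; exact: enum_val_bij.
by apply: eq_bigr => i _; rewrite mxE /c enum_valK enum_rankK.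
Qed.

End IteratedPolynomials.

(** In characteristic 0 the first [size p] naturals are distinct, which is more than [p] has
    roots. *)
Lemma poly_nonroot (K : numFieldType) (p : {poly K}) :
  p != 0 -> exists z, p.[z] != 0.
Proof.
move=> p0; pose s := [seq i%:R : K | i <- iota 0 (size p)].
have us : uniq s.
  by rewrite map_inj_uniq ?iota_uniq // => i j /eqP; rewrite eqr_nat => /eqP.
have /allPn[z _ pz] : ~~ all (root p) s.
  apply/negP => sp; have := max_poly_roots p0 sp us.
  by rewrite size_map size_iota ltnn.
by exists z.
Qed.

Lemma polynomial_function_line (K : fieldType) (V : vectType K) (P : V -> K) :
  polynomial_function P ->
  forall v w, exists p : {poly K}, forall z, P (v + z *: w) = p.[z].
Proof.
elim=> [c|l|f g _ IHf _ IHg|f g _ IHf _ IHg] v w.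
- by exists c%:P => z; rewrite hornerC.
- exists ((l v)%:P + (l w)%:P * 'X) => z.
  by rewrite linearD linearZ /= !hornerE mulrC.
- have [[p pE] [q qE]] := (IHf v w, IHg v w).
  by exists (p + q) => z; rewrite pE qE hornerD.
- have [[p pE] [q qE]] := (IHf v w, IHg v w).
  by exists (p * q) => z; rewrite pE qE hornerM.
Qed.

(** * Irreducibility of affine subspaces *)

Section AffineSets.
Variables (K : numFieldType) (V : vectType K) (X : Type) (iota : X -> V).

(** The image of [T] is an affine subspace, possibly empty; lines are the form in which
    irreducibility is tested. *)
Definition line_closed (T : set X) := forall x y, T x -> T y -> forall z,
  exists2 t, T t & iota t = iota x + z *: (iota y - iota x).

(** Join a point where [P] is nonzero to one where [S] is nonzero. On this line both are nonzero
    univariate polynomials, so their product is nonzero at some point of it. *)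
Lemma line_closed_integral (T : set X) (P S : V -> K) : line_closed T ->
  polynomial_function P -> polynomial_function S ->
  (forall t, T t -> P (iota t) * S (iota t) = 0) ->
  (forall t, T t -> P (iota t) = 0) \/ (forall t, T t -> S (iota t) = 0).
Proof.
move=> Tl Pp Sp PS0; apply: contrapT => /not_orP[].
move=> /existsNP[x /not_implyP[Tx /eqP Px]].
move=> /existsNP[y /not_implyP[Ty /eqP Sy]].
have [p pE] := polynomial_function_line Pp (iota x) (iota y - iota x).
have [q qE] := polynomial_function_line Sp (iota x) (iota y - iota x).
have p0 : p != 0.
  apply: contraNneq Px => p0.
  by rewrite -[iota x]addr0 -(scale0r (iota y - iota x)) pE p0 horner0.
have q0 : q != 0.
  apply: contraNneq Sy => q0.
  by rewrite -[iota y](subrKC (iota x)) -[_ - _]scale1r qE q0 horner0.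
have [z] := poly_nonroot (mulf_neq0 p0 q0); rewrite hornerM -pE -qE.
by have [t Tt <-] := Tl x y Tx Ty z; rewrite PS0 ?eqxx.
Qed.

End AffineSets.

(** * Chains of primes made of vanishing ideals *)

Section FunctionRing.
Variables (K : numFieldType) (V : vectType K) (X : Type) (iota : X -> V).
Variables (A : comNzRingType) (ev : X -> {rmorphism A -> K}).
Hypothesis ev_regular : forall a,
  exists2 P, polynomial_function P & forall x, ev x a = P (iota x).

(** Primality comes from [line_closed_integral], and a point of [T] keeps 1 out of the ideal. *)
Lemma vanishing_ideal (T : set X) : line_closed iota T -> T !=set0 ->
  exists p : Spec A, forall a,
    (a \in (p : {pred A})) <-> (forall t, T t -> ev t a = 0).
Proof.
move=> Tl [t0 Tt0].
pose S : A -> bool := fun a => `[< forall t, T t -> ev t a = 0 >].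
have Sid : idealr_closed (S : {pred A}).
  split; first by apply/asboolP => t _; rewrite rmorph0.
    by apply/asboolP => /(_ t0 Tt0)/eqP; rewrite rmorph1 oner_eq0.
  move=> a u v /asboolP u0 /asboolP v0; apply/asboolP => t Tt.
  by rewrite rmorphD rmorphM u0 // v0 // mulr0 addr0.
have Spr : prime_idealr_closed (S : {pred A}).
  move=> u v /asboolP uv0.
  have [P Pp PE] := ev_regular u; have [P' Pp' PE'] := ev_regular v.
  have [t Tt||] := line_closed_integral Tl Pp Pp'.
  - by rewrite -PE -PE' -rmorphM uv0.
  - by move=> u0; apply/orP; left; apply/asboolP => t Tt; rewrite PE u0.
  - by move=> u0; apply/orP; right; apply/asboolP => t Tt; rewrite PE' u0.
pose i1 := isIdealr.Build A S Sid.
pose i2 := isPrimeIdealrClosed.Build A S Spr.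
pose p : prime_idealr A := HB.pack S i1 i2.
by exists p => a; split => [/asboolP|] // h; exact/asboolP.
Qed.

(** Smaller sets have larger ideals, and [a] witnesses strictness at step [k]. *)
Lemma vanishing_chain (T : nat -> set X) d :
  (forall k, line_closed iota (T k)) -> (forall k, T k !=set0) ->
  (forall k, T k.+1 `<=` T k) ->
  (forall k, (k < d)%N -> exists2 a, forall t, T k.+1 t -> ev t a = 0 &
     exists2 t, T k t & ev t a != 0) ->
  exists c : nat -> Spec A, prime_chain c d.
Proof.
move=> Tl T0 Tdec Ta.
have /choice[c cP] := fun k => vanishing_ideal (Tl k) (T0 k).
exists c => k kd; split.
  by move=> a /cP a0; apply/cP => t /Tdec; exact: a0.
have [a a0 [t Tt at0]] := Ta k kd.
by move=> /(_ a); rewrite !cP => /(_ a0)/(_ t Tt)/eqP; apply/negP.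
Qed.

(** * Krull dimension from an affine chart with coordinates [y] *)

Section Chart.
Variables (T : set X) (J : finType) (y : J -> X -> K) (b0 : V) (b : J -> V).
Hypothesis chartE : forall x, T x -> iota x = b0 + \sum_j y j x *: b j.
Hypothesis chart_surj : forall c : J -> K, exists2 x, T x & y^~ x =1 c.

Lemma chart_slice_line_closed (B : set J) (s : J -> K) :
  line_closed iota [set x | T x /\ forall j, B j -> y j x = s j].
Proof.
move=> x x' [Tx Bx] [Tx' Bx'] z.
have [t Tt tE] := chart_surj (fun j => y j x + z * (y j x' - y j x)).
exists t; first by split=> // j Bj; rewrite tE Bx // Bx' // subrr mulr0 addr0.
rewrite !chartE // opprD addrACA subrr add0r -addrA; congr (_ + _).
rewrite -sumrB scaler_sumr -big_split /=; apply: eq_bigr => j _.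
by rewrite tE scalerDl -scalerBl scalerA.
Qed.

(** The chain belongs to the flag obtained by freezing the coordinates one after another at the
    values [s]. The choice of [s] lets the flag end at a point near which suitable functions do not
    vanish identically. *)
Lemma chart_chain (s : J -> K) :
  (forall j, exists2 a, forall x, T x -> y j x = s j -> ev x a = 0 &
     forall x, T x -> y j x = s j + 1 ->
       (forall i, i != j -> y i x = s i) -> ev x a != 0) ->
  exists c : nat -> Spec A, prime_chain c #|J|.
Proof.
move=> sa.
pose B k := [set j : J | (enum_rank j < k)%N].
pose Tk k := [set x | T x /\ forall j, B k j -> y j x = s j].
apply: (@vanishing_chain Tk).
- by move=> k; exact: chart_slice_line_closed.
- by move=> k; have [x Tx xs] := chart_surj s; exists x; split=> // j _.
- move=> k x [Tx xs]; split=> // j Bj; apply: xs; exact: ltnW Bj.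
- move=> k kJ; pose j := enum_val (Ordinal kJ); have [a a0 a1] := sa j.
  exists a => [x [Tx xs]|].
    by apply: a0 => //; apply: xs; rewrite /B /= enum_valK.
  (* This point differs from [s] in coordinate [j] alone: it meets the first [k] conditions but not
     the next one. *)
  have [x Tx xs] := chart_surj (fun i => s i + (i == j)%:R); exists x.
    split=> // i; rewrite /B /= => ik; rewrite xs; case: eqP => [ij|_].
      by rewrite ij enum_valK ltnn in ik.
    by rewrite addr0.
  apply: a1 => //; first by rewrite xs eqxx.
  by move=> i /negbTE ij; rewrite xs ij addr0.
Qed.

(** The coordinates numbered by naturals, as [ieval] takes them, and 0 past the last one. *)
Let yn x k : K :=
  if insub k is Some k' then y (@enum_val J xpredT k') x else 0.

Lemma chart_polynomial (P : V -> K) : polynomial_function P ->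
  exists Q : ipoly K #|J|, forall x, T x ->
    P (iota x) = ieval (idfun : {rmorphism K -> K}) #|J| (yn x) Q.
Proof.
elim=> [c|l|f g _ [p pE] _ [q qE]|f g _ [p pE] _ [q qE]].
- by exists (iconst K _ c) => x Tx; rewrite ieval_const.
- exists (iconst K _ (l b0) +
    \sum_(k < #|J|) iconst K _ (l (b (enum_val k))) * ivar K #|J| k) => x Tx.
  rewrite chartE // linearD linear_sum rmorphD ieval_const rmorph_sum /=.
  congr (_ + _); rewrite (reindex (@enum_val J xpredT)) /=; last first.
    by apply: onW_bij; exact: enum_val_bij.
  apply: eq_bigr => k _; rewrite rmorphM ieval_const ieval_var // /yn valK.
  by rewrite linearZ /= mulrC.
- by exists (p + q) => x Tx; rewrite pE // qE // rmorphD.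
- by exists (p * q) => x Tx; rewrite pE // qE // rmorphM.
Qed.

Variable k : {rmorphism K -> A}.
Hypothesis ev_k : forall x c, ev x (k c) = c.
Hypothesis ev_inj : forall a, (forall x, T x -> ev x a = 0) -> a = 0.

(** A chain of length [#|J|.+1] gives as many elements [x i], each new at its step, which satisfy no
    polynomial relation modulo [c 0]. But on [T] they are polynomials in [#|J|] coordinates, hence
    satisfy one there, and by [ev_inj] it holds in [A]. *)
Lemma chart_chain_le (c : nat -> Spec A) l : prime_chain c l -> (l <= #|J|)%N.
Proof.
move=> cP; rewrite leqNgt; apply/negP => Jl.
have {cP} cP : prime_chain c #|J|.+1.
  by move=> i iJ; apply: cP; exact: leq_trans Jl.
have /choice[x xP] i : exists a, (i < #|J|.+1)%N ->
    a \in (c i.+1 : {pred A}) /\ a \notin (c i : {pred A}).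
  case: (ltnP i #|J|.+1) => [iJ|]; last by exists 0.
  have [_ /existsNP[a /not_implyP[a1 a0]]] := cP i iJ.
  by exists a => _; split=> //; exact/negP.
have /choice[p pP] i : exists p : ipoly K #|J|, forall t, T t ->
    ev t (x i) = ieval (idfun : {rmorphism K -> K}) #|J| (yn t) p.
  have [P Pp PE] := ev_regular (x i); have [p pE] := chart_polynomial Pp.
  by exists p => t Tt; rewrite PE pE.
have [Q Q0 QE] := ipoly_alg_dep p.
have := prime_chain_alg_indep k cP xP Q0.
suff -> : ieval k #|J|.+1 x Q = 0 by rewrite idealr0.
apply: ev_inj => t Tt.
rewrite (@ieval_morph _ _ _ _ (idfun : {rmorphism K -> K})) => [|a]; last first.
  by rewrite /= ev_k.
rewrite -(rmorph0 (ieval (idfun : {rmorphism K -> K}) #|J| (yn t))) -QE.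
rewrite (@ieval_morph _ _ _ _ (idfun : {rmorphism K -> K})) => [|a]; last first.
  by rewrite /= ieval_const.
by apply: eq_ieval => i _ /=; rewrite pP.
Qed.

Lemma dim_Spec_chart (s : J -> K) :
  (forall j, exists2 a, forall x, T x -> y j x = s j -> ev x a = 0 &
     forall x, T x -> y j x = s j + 1 ->
       (forall i, i != j -> y i x = s i) -> ev x a != 0) ->
  dim_Spec A #|J|.
Proof. by move=> sa; split; [exact: chart_chain sa | exact: chart_chain_le]. Qed.

End Chart.
End FunctionRing.

(** * Evaluations and constants in coordinate rings and in rings of invariants *)

Section CoordinateRings.
Variables (K : fieldType) (V : vectType K) (X : pointedType) (iota : X -> V).

Definition coord_eval (x : X) (f : coord_ring iota) : K := f x.

Fact coord_eval_zmod_morphism x : zmod_morphism (coord_eval x).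
Proof. by []. Qed.

Fact coord_eval_monoid_morphism x : monoid_morphism (coord_eval x).
Proof. by []. Qed.

HB.instance Definition _ x := GRing.isZmodMorphism.Build (coord_ring iota) K
  (coord_eval x) (coord_eval_zmod_morphism x).
HB.instance Definition _ x := GRing.isMonoidMorphism.Build (coord_ring iota) K
  (coord_eval x) (coord_eval_monoid_morphism x).

Lemma coord_eval_inj (f g : coord_ring iota) :
  (forall x, coord_eval x f = coord_eval x g) -> f = g.
Proof. by move=> fg; apply/val_inj/funext. Qed.

Lemma coord_eval_regular (f : coord_ring iota) :
  exists2 P, polynomial_function P & forall x, coord_eval x f = P (iota x).
Proof. exact/asboolP/(coord_fun_regular f). Qed.

Fact polynomial_regular P : polynomial_function P -> P \o iota \in regular iota.
Proof. by move=> Pp; apply/asboolP; exists P. Qed.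

Definition polynomial_coord P (Pp : polynomial_function P) : coord_ring iota :=
  CoordRing (polynomial_regular Pp).

Definition coord_const (c : K) := polynomial_coord (PolyConst V c).

Fact coord_const_zmod_morphism : zmod_morphism coord_const.
Proof. by move=> c d; apply: coord_eval_inj => x; rewrite rmorphB. Qed.

Fact coord_const_monoid_morphism : monoid_morphism coord_const.
Proof.
by split=> [|c d]; apply: coord_eval_inj => x; rewrite ?rmorph1 ?rmorphM.
Qed.

HB.instance Definition _ := GRing.isZmodMorphism.Build K (coord_ring iota)
  coord_const coord_const_zmod_morphism.
HB.instance Definition _ := GRing.isMonoidMorphism.Build K (coord_ring iota)
  coord_const coord_const_monoid_morphism.

Variables (G : Type) (action : G -> X -> X).
Local Notation inv_ring := (invariant_ring iota action).

Definition inv_eval (x : X) (f : inv_ring) : K := coord_eval x (invariant_fun f).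

Fact inv_eval_zmod_morphism x : zmod_morphism (inv_eval x).
Proof. by []. Qed.

Fact inv_eval_monoid_morphism x : monoid_morphism (inv_eval x).
Proof. by []. Qed.

HB.instance Definition _ x := GRing.isZmodMorphism.Build inv_ring K
  (inv_eval x) (inv_eval_zmod_morphism x).
HB.instance Definition _ x := GRing.isMonoidMorphism.Build inv_ring K
  (inv_eval x) (inv_eval_monoid_morphism x).

Lemma inv_eval_inj (f g : inv_ring) :
  (forall x, inv_eval x f = inv_eval x g) -> f = g.
Proof. by move=> fg; apply/val_inj/coord_eval_inj. Qed.

Lemma inv_eval_action (f : inv_ring) g x : inv_eval (action g x) f = inv_eval x f.
Proof. exact: (asboolP _ (invariant_funP f)). Qed.

Lemma inv_eval_regular (f : inv_ring) :
  exists2 P, polynomial_function P & forall x, inv_eval x f = P (iota x).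
Proof. exact: coord_eval_regular. Qed.

Fact polynomial_invariant P (Pp : polynomial_function P) :
  (forall g x, P (iota (action g x)) = P (iota x)) ->
  polynomial_coord Pp \in Defs.invariant (iota := iota) action.
Proof. by move=> PG; apply/asboolP => g x; exact: PG. Qed.

Definition inv_const (c : K) : inv_ring :=
  InvariantRing (@polynomial_invariant _ (PolyConst V c) (fun _ _ => erefl)).

Fact inv_const_zmod_morphism : zmod_morphism inv_const.
Proof. by move=> c d; apply: inv_eval_inj => x; rewrite rmorphB. Qed.

Fact inv_const_monoid_morphism : monoid_morphism inv_const.
Proof.
by split=> [|c d]; apply: inv_eval_inj => x; rewrite ?rmorph1 ?rmorphM.
Qed.

HB.instance Definition _ := GRing.isZmodMorphism.Build K inv_ring
  inv_const inv_const_zmod_morphism.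
HB.instance Definition _ := GRing.isMonoidMorphism.Build K inv_ring
  inv_const inv_const_monoid_morphism.

End CoordinateRings.

(** * Triangular matrices and equivariant frames *)

Section UpperTriangular.
Variables (K : fieldType) (n : nat).
Implicit Types (A B X u : 'M[K]_n) (i j m : 'I_n).

(** [is_trig_mx] means lower triangular, hence the transpose. *)
Definition upper A := is_trig_mx A^T.

Lemma upperP A : reflect (forall i j, (j < i)%N -> A i j = 0) (upper A).
Proof.
by apply: (iffP is_trig_mxP) => A0 i j ij; have := A0 j i ij; rewrite mxE.
Qed.

Lemma diag_upper A : is_diag_mx A -> upper A.
Proof. by rewrite is_diag_mxEtrig => /andP[]. Qed.

Lemma upperM A B : upper A -> upper B -> upper (A *m B).
Proof.
move=> /upperP A0 /upperP B0; apply/upperP => i j ji; rewrite mxE big1 // => k _.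
have [ki|ik] := ltnP k i; first by rewrite A0 // mul0r.
by rewrite B0 ?mulr0 // (leq_trans ji).
Qed.

Lemma upperM_diag A B i : upper A -> upper B -> (A *m B) i i = A i i * B i i.
Proof.
move=> /upperP A0 /upperP B0; rewrite mxE (bigD1 i) //= big1 ?addr0 // => k ki.
have [{}ki|ik] := ltnP k i; first by rewrite A0 // mul0r.
by rewrite B0 ?mulr0 // ltn_neqAle ik andbT eq_sym.
Qed.

Lemma upperB A B : upper A -> upper B -> upper (A - B).
Proof.
move=> /upperP A0 /upperP B0; apply/upperP => i j ji.
by rewrite !mxE A0 // B0 // subrr.
Qed.

Lemma upperZ a A : upper A -> upper (a *: A).
Proof. by move=> /upperP A0; apply/upperP => i j ji; rewrite mxE A0 ?mulr0. Qed.

Lemma det_upper A : upper A -> \det A = \prod_i A i i.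
Proof.
by move=> uA; rewrite -det_tr det_trig //; apply: eq_bigr => i _; rewrite mxE.
Qed.

Lemma upper_unit_diag A i : upper A -> A \in unitmx -> A i i != 0.
Proof.
move=> uA; rewrite unitmxE unitfE det_upper // prodf_seq_neq0.
by move=> /allP/(_ i (mem_index_enum i)).
Qed.

(** Induction on the column: below the diagonal, entry [(i, j)] of [invmx A *m A] reduces to
    [invmx A i j * A j j], and [A j j] is nonzero. *)
Lemma upper_inv A : upper A -> upper (invmx A).
Proof.
(* For singular [A] the default value of [invmx A] is [A] itself. *)
move=> uA; have [Au|Au] := boolP (A \in unitmx); last by rewrite invmx_out.
have /upperP A0 := uA; apply/upperP => i j; have [m] := ubnP j.
elim: m j => // m IH j jm ji; have : (invmx A *m A) i j = 0.
  by rewrite mulVmx // mxE; case: eqP => // ij; rewrite ij ltnn in ji.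
rewrite mxE (bigD1 j) //= big1 ?addr0 => [/eqP|k kj].
  by rewrite mulf_eq0 (negbTE (upper_unit_diag _ uA Au)) orbF => /eqP.
have [{}kj|jk] := ltnP k j.
  by rewrite (IH k (leq_trans kj jm) (ltn_trans kj ji)) mul0r.
by rewrite A0 ?mulr0 // ltn_neqAle jk andbT eq_sym.
Qed.

(** The adjugate serves throughout as a polynomial substitute for the inverse. *)
Lemma adj_unit A : A \in unitmx -> \adj A = \det A *: invmx A.
Proof.
by move=> Au; rewrite -[\adj A](mulmxK Au) mul_adj_mx mul_scalar_mx.
Qed.

Lemma upper_adj A : A \in unitmx -> upper A -> upper (\adj A).
Proof. by move=> Au uA; rewrite adj_unit // upperZ // upper_inv. Qed.

Lemma unitmx_adj A : A \in unitmx -> \adj A \in unitmx.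
Proof.
move=> Au; rewrite adj_unit // -mul_scalar_mx unitmx_mul unitmx_inv Au andbT.
by rewrite unitmxE det_scalar unitrX // -unitmxE.
Qed.

Lemma is_diagE A : is_diag_mx A = upper A && upper A^T.
Proof. by rewrite is_diag_mxEtrig andbC /upper trmxK. Qed.

Lemma diagM A B : is_diag_mx A -> is_diag_mx B -> is_diag_mx (A *m B).
Proof.
rewrite !is_diagE trmx_mul => /andP[uA lA] /andP[uB lB].
by rewrite !upperM.
Qed.

Lemma diag_adj A : A \in unitmx -> is_diag_mx A -> is_diag_mx (\adj A).
Proof.
rewrite !is_diagE trmx_adj => Au /andP[uA lA].
by rewrite !upper_adj ?unitmx_tr.
Qed.

Lemma diag_inv A : is_diag_mx A -> is_diag_mx (invmx A).
Proof. by rewrite !is_diagE trmx_inv => /andP[uA lA]; rewrite !upper_inv. Qed.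

Lemma mulmx_diagr A B i j : is_diag_mx B -> (A *m B) i j = A i j * B j j.
Proof.
by move=> /diag_mxP [d ->]; rewrite mul_mx_diag !mxE eqxx.
Qed.

(** Extended by 0 to all naturals, so that [eigen_prod] can recurse on its number of factors. *)
Definition diag_entry X k := if insub k is Some i then X i i else 0.

Fixpoint eigen_prod X k : 'M[K]_n :=
  if k is k'.+1 then eigen_prod X k' *m (X - (diag_entry X k')%:M) else 1%:M.

(* Column [j] is an eigenvector of [X] for the eigenvalue [X j j]. *)
Definition eigen_mx X : 'M[K]_n := \matrix_(i, j) eigen_prod X j i j.

Lemma diag_entry_ord X i : diag_entry X i = X i i.
Proof. by rewrite /diag_entry valK. Qed.

Lemma upper_eigen_prod X k : upper X -> upper (eigen_prod X k).
Proof.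
move=> uX; have us a : upper a%:M by apply/diag_upper/scalar_mx_is_diag.
by elim: k => [|k IH] /=; rewrite ?us // upperM // upperB.
Qed.

(** For [m <= k], the last factor [X - X k k] sends basis vector [m] into the span of the first [k]
    ones, which the preceding factors kill. *)
Lemma eigen_prod_eq0 X k i m : upper X -> (m < k)%N -> eigen_prod X k i m = 0.
Proof.
move=> uX; elim: k i m => // k IH i m mk /=; rewrite mxE big1 // => l _.
have [lk|kl] := ltnP l k; first by rewrite IH // mul0r.
have -> : (X - (diag_entry X k)%:M) l m = 0; last by rewrite mulr0.
have [lm|ml] := eqVneq l m.
  have {}kl : l = k :> nat by apply/eqP; rewrite eqn_leq kl andbT lm.
  by rewrite -{}lm -kl diag_entry_ord !mxE eqxx subrr.
have uS : upper (X - (diag_entry X k)%:M).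
  by apply/upperB/diag_upper/scalar_mx_is_diag.
apply: (upperP _ uS).
by rewrite ltn_neqAle eq_sym ml (leq_trans (mk : (m <= k)%N)).
Qed.

Lemma eigen_prodC X k : X *m eigen_prod X k = eigen_prod X k *m X.
Proof.
elim: k => [|k IH] /=; first by rewrite mulmx1 mul1mx.
by rewrite mulmxA IH -!mulmxA mulmxBr mulmxBl scalar_mxC.
Qed.

Lemma eigen_mx_eigen X : upper X ->
  X *m eigen_mx X = eigen_mx X *m diag_mx (\row_j X j j).
Proof.
move=> uX; apply/matrixP => i j; rewrite mul_mx_diag !mxE.
transitivity ((X *m eigen_prod X j) i j).
  by rewrite mxE; apply: eq_bigr => k _; rewrite mxE.
(* Column [j] of the product with one more factor vanishes; as [X] commutes with [eigen_prod X j],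
   this is the eigenvector equation. *)
have := eigen_prod_eq0 i uX (ltnSn j); rewrite [eigen_prod _ _]/=.
rewrite diag_entry_ord mulmxBr mul_mx_scalar eigen_prodC !mxE.
by move/eqP; rewrite subr_eq0 => /eqP->; rewrite mulrC.
Qed.

Lemma upper_eigen_mx X : upper X -> upper (eigen_mx X).
Proof.
move=> uX; apply/upperP => i j ji; rewrite mxE.
exact: (upperP _ (upper_eigen_prod j uX)).
Qed.

Lemma diag_eigen_prod X k : is_diag_mx X -> is_diag_mx (eigen_prod X k).
Proof.
move=> dX; elim: k => [|k IH] /=; first exact: scalar_mx_is_diag.
apply: diagM => //; apply/is_diag_mxP => i j ij; rewrite !mxE.
by rewrite (is_diag_mxP dX) // -val_eqE (negbTE ij) subr0.
Qed.

Lemma diag_eigen_mx X : is_diag_mx X -> is_diag_mx (eigen_mx X).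
Proof.
move=> dX; apply/is_diag_mxP => i j ij; rewrite mxE.
exact: (is_diag_mxP (diag_eigen_prod _ dX)).
Qed.

(** Diagonal entry [i] of the triangular matrix [eigen_mx X] is the product of the differences
    [X i i - X l l] over [l < i]. *)
Lemma eigen_mx_unit X : upper X -> injective (fun i => X i i) ->
  eigen_mx X \in unitmx.
Proof.
move=> uX Xinj; rewrite unitmxE unitfE det_upper ?upper_eigen_mx //.
apply/prodf_neq0 => i _; rewrite mxE.
have: (i <= i)%N by []; elim: {-2}(i : nat) => [|k IH] ki.
  by rewrite mxE eqxx oner_eq0.
rewrite /= upperM_diag ?upper_eigen_prod //; last first.
  by apply/upperB/diag_upper/scalar_mx_is_diag.
rewrite mulf_neq0 ?IH ?(ltnW ki) // !mxE eqxx subr_eq0.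
have kn : (k < n)%N := ltn_trans ki (ltn_ord i).
rewrite -[k]/(val (Ordinal kn)) diag_entry_ord; apply/eqP => /Xinj ik.
by rewrite ik ltnn in ki.
Qed.

End UpperTriangular.

(** * Behaviour under multiplication by unipotent matrices *)

Section Unipotent.
Variables (K : fieldType) (n : nat).
Implicit Types (u : unipotent K n) (X : 'M[K]_n).

Lemma upper_unipotent u : upper u.
Proof.
have /andP[/forallP u0 _] := unipotent_mxP u; apply/upperP => i j ji.
exact/eqP/(implyP (forallP (u0 i) j)).
Qed.

Lemma unipotent_diag u i : u i i = 1 :> K.
Proof. by have /andP[_ /forallP u1] := unipotent_mxP u; exact/eqP. Qed.

Lemma det_unipotent u : \det u = 1.
Proof.
rewrite det_upper ?upper_unipotent // big1 // => i _; exact: unipotent_diag.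
Qed.

Lemma unipotentV_diag u i : (invmx u) i i = 1 :> K.
Proof.
have := upperM_diag i (upper_unipotent u) (upper_inv (upper_unipotent u)).
by rewrite mulmxV ?unipotent_unit // unipotent_diag mul1r mxE eqxx.
Qed.

Lemma upper_conj u u' X : upper X -> upper (u *m X *m invmx u').
Proof.
by move=> uX; rewrite !upperM ?upper_inv ?upper_unipotent.
Qed.

Lemma conj_diag u u' X i : upper X -> (u *m X *m invmx u') i i = X i i.
Proof.
move=> uX; have uu := upper_unipotent u; have uu' := upper_unipotent u'.
rewrite !upperM_diag ?upperM ?upper_inv //.
by rewrite unipotentV_diag unipotent_diag mul1r mulr1.
Qed.

(** Conjugation keeps the diagonal entries of [X], hence conjugates each factor. *)
Lemma eigen_prod_conj u X k : upper X ->
  eigen_prod (u *m X *m invmx u) k = u *m eigen_prod X k *m invmx u.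
Proof.
move=> uX; elim: k => [|k IH] /=.
  by rewrite mulmx1 mulmxV ?unipotent_unit.
have -> : diag_entry (u *m X *m invmx u) k = diag_entry X k.
  by rewrite /diag_entry; case: insubP => // i _ _; rewrite conj_diag.
set x := _%:M; have -> : u *m X *m invmx u - x = u *m (X - x) *m invmx u.
  rewrite mulmxBr mulmxBl; congr (_ - _).
  by rewrite -mulmxA -scalar_mxC mulmxA mulmxV ?mul1mx ?unipotent_unit.
by rewrite IH -!mulmxA (mulKmx (unipotent_unit u)).
Qed.

(** The right factor [invmx u] disappears: in column [j], the columns of [eigen_prod X j] before [j]
    vanish, and [invmx u] is 0 below its diagonal and 1 on it. *)
Lemma eigen_mx_conj u X : upper X ->
  eigen_mx (u *m X *m invmx u) = u *m eigen_mx X.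
Proof.
move=> uX; apply/matrixP => i j; rewrite !mxE eigen_prod_conj // mxE.
rewrite (bigD1 j) //= unipotentV_diag mulr1 mxE.
rewrite [X in _ + X]big1 ?addr0 => [|k kj].
  by apply: eq_bigr => k _; rewrite mxE.
have [{}kj|jk] := ltnP k j.
  by rewrite mxE big1 ?mul0r // => l _; rewrite eigen_prod_eq0 ?mulr0.
rewrite (upperP _ (upper_inv (upper_unipotent u))) ?mulr0 //.
by rewrite ltn_neqAle jk andbT eq_sym.
Qed.

Lemma unipotent_of (A : 'M[K]_n) : upper A -> (forall i, A i i = 1) ->
  exists u : unipotent K n, u = A :> 'M[K]_n.
Proof.
move=> uA A1; suff AU : A \in @unitriangular K n by exists (Unipotent AU).
apply/andP; split; apply/forallP => i; last by rewrite A1.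
by apply/forallP => j; apply/implyP => ji; rewrite (upperP _ uA).
Qed.

End Unipotent.

(** * Polynomial dependence of matrix constructions *)

Section PolynomialFunctions.
Variables (K : fieldType) (V : vectType K).
Implicit Types f g : V -> K.

Lemma eq_polynomial_function f g :
  f =1 g -> polynomial_function f -> polynomial_function g.
Proof. by move=> /funext ->. Qed.

Lemma polynomial_function_sum (I : Type) (r : seq I) (F : I -> V -> K) :
  (forall i, polynomial_function (F i)) ->
  polynomial_function (fun v => \sum_(i <- r) F i v).
Proof.
move=> Fp; elim: r => [|i r IH].
  by apply: eq_polynomial_function (PolyConst _ 0) => v; rewrite big_nil.
by apply: eq_polynomial_function (PolyAdd (Fp i) IH) => v; rewrite big_cons.
Qed.

Lemma polynomial_function_prod (I : Type) (r : seq I) (F : I -> V -> K) :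
  (forall i, polynomial_function (F i)) ->
  polynomial_function (fun v => \prod_(i <- r) F i v).
Proof.
move=> Fp; elim: r => [|i r IH].
  by apply: eq_polynomial_function (PolyConst _ 1) => v; rewrite big_nil.
by apply: eq_polynomial_function (PolyMul (Fp i) IH) => v; rewrite big_cons.
Qed.

Definition polynomial_mx m n (F : V -> 'M[K]_(m, n)) :=
  forall i j, polynomial_function (fun v => F v i j).

Lemma polynomial_mxM m n p (F : V -> 'M[K]_(m, n)) (G : V -> 'M[K]_(n, p)) :
  polynomial_mx F -> polynomial_mx G -> polynomial_mx (fun v => F v *m G v).
Proof.
move=> Fp Gp i j.
apply: (@eq_polynomial_function (fun v => \sum_k F v i k * G v k j)).
  by move=> v; rewrite mxE.
by apply: polynomial_function_sum => k; exact: PolyMul.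
Qed.

Lemma polynomial_mx_const m n (A : 'M[K]_(m, n)) : polynomial_mx (fun=> A).
Proof. by move=> i j; exact: PolyConst. Qed.

Lemma polynomial_function_det n (F : V -> 'M[K]_n) :
  polynomial_mx F -> polynomial_function (fun v => \det (F v)).
Proof.
move=> Fp; rewrite /determinant; apply: polynomial_function_sum => s.
apply: (@PolyMul _ _ (fun=> _)); first exact: PolyConst.
by apply: polynomial_function_prod => i; exact: Fp.
Qed.

Lemma polynomial_mx_adj n (F : V -> 'M[K]_n) :
  polynomial_mx F -> polynomial_mx (fun v => \adj (F v)).
Proof.
move=> Fp i j; apply: (@eq_polynomial_function (fun v => cofactor (F v) j i)).
  by move=> v; rewrite mxE.
apply: (@PolyMul _ _ (fun=> (-1) ^+ (j + i))); first exact: PolyConst.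
apply: polynomial_function_det => k l.
apply: (@eq_polynomial_function (fun v => F v (lift j k) (lift i l))) => //.
by move=> v; rewrite !mxE.
Qed.

Lemma polynomial_eigen_prod n (F : V -> 'M[K]_n) k :
  polynomial_mx F -> polynomial_mx (fun v => eigen_prod (F v) k).
Proof.
move=> Fp; elim: k => [|k IH]; first exact: polynomial_mx_const.
apply: polynomial_mxM => // i j.
apply: (@eq_polynomial_function (fun v => F v i j +
   (-1 * diag_entry (F v) k) * (i == j)%:R)).
  by move=> v; rewrite !mxE mulr_natr mulN1r mulNrn.
apply/PolyAdd/PolyMul/PolyConst => //; apply/PolyMul; first exact: PolyConst.
by rewrite /diag_entry; case: insub => [l|]; [exact: Fp | exact: PolyConst].
Qed.

Lemma polynomial_eigen_mx n (F : V -> 'M[K]_n) :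
  polynomial_mx F -> polynomial_mx (fun v => eigen_mx (F v)).
Proof.
move=> Fp i j.
apply: eq_polynomial_function (polynomial_eigen_prod j Fp i j) => v.
by rewrite mxE.
Qed.

End PolynomialFunctions.

(** * Families of matrices with their entries as linear coordinates *)

Section MatrixFamilies.
Variables (K : fieldType) (I : finType) (n : nat).
Implicit Types (W : {ffun I -> 'M[K]_n}) (t : I * ('I_n * 'I_n)).

Definition entry W t : K := W t.1 t.2.1 t.2.2.

Definition unit_family t : {ffun I -> 'M[K]_n} :=
  [ffun a => if a == t.1 then delta_mx t.2.1 t.2.2 else 0].

Lemma entry_unit_family t t' : entry (unit_family t) t' = (t' == t)%:R.
Proof.
case: t t' => [a [i j]] [a' [i' j']] /=.
rewrite /entry ffunE -!pair_eqE /=.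
by rewrite /pair_eq /=; case: eqP => _; rewrite mxE.
Qed.

Lemma entry_sum (J : finType) (c : J -> K) (F : J -> {ffun I -> 'M[K]_n}) t :
  entry (\sum_j c j *: F j) t = \sum_j c j * entry (F j) t.
Proof.
by rewrite /entry sum_ffunE summxE; apply: eq_bigr => j _; rewrite ffunE mxE.
Qed.

Lemma entryP W W' : (forall t, entry W t = entry W' t) -> W = W'.
Proof.
by move=> WW'; apply/ffunP => a; apply/matrixP => i j; exact: (WW' (a, (i, j))).
Qed.

Fact entry_linear t :
  scalar (entry^~ t : {ffun I -> 'M[K]_n} -> K).
Proof. by move=> c W W'; rewrite /entry !ffunE !mxE. Qed.

Lemma polynomial_entry t :
  polynomial_function (entry^~ t : {ffun I -> 'M[K]_n} -> K).
Proof.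
pose l : {scalar {ffun I -> 'M[K]_n}} :=
  HB.pack (fun W : {ffun I -> 'M[K]_n} => entry W t)
  (GRing.isLinear.Build K {ffun I -> 'M[K]_n} K _ _ (entry_linear t)).
exact: (PolyLin l).
Qed.

Variable P : pred (I * ('I_n * 'I_n)).
Local Notation J := {t | P t}.

Definition family_of (c : J -> K) := \sum_(t : J) c t *: unit_family (val t).

Lemma entry_family_of c (t : J) : entry (family_of c) (val t) = c t.
Proof.
rewrite entry_sum (bigD1 t) //= entry_unit_family eqxx mulr1.
rewrite big1 ?addr0 // => t' t't; rewrite entry_unit_family val_eqE eq_sym.
by rewrite (negbTE t't) mulr0.
Qed.

Lemma entry_family_of0 c t : ~~ P t -> entry (family_of c) t = 0.
Proof.
move=> Pt; rewrite entry_sum big1 // => t' _; rewrite entry_unit_family.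
by case: eqP => [tt'|_]; rewrite ?mulr0 //; rewrite tt' (valP t') in Pt.
Qed.

Lemma family_ofK W : (forall t, ~~ P t -> entry W t = 0) ->
  W = family_of (fun t : J => entry W (val t)).
Proof.
move=> W0; apply: entryP => t; have [Pt|Pt] := boolP (P t); last first.
  by rewrite W0 // entry_family_of0.
by rewrite -[t]/(val (exist (fun t => P t) t Pt)) entry_family_of.
Qed.

(** The unit families at the indices in [P] form a basis of [U]. *)
Lemma dim_family (U : {vspace {ffun I -> 'M[K]_n}}) :
  (forall W, W \in U <-> forall t, ~~ P t -> entry W t = 0) ->
  \dim U = #|{: J}|.
Proof.
move=> UP.
pose b := [tuple unit_family (val (@enum_val J xpredT k)) | k < #|{: J}|].
have sumE (c : 'I_#|{: J}| -> K) :
    \sum_k c k *: b`_k = family_of (fun t : J => c (enum_rank t)).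
  rewrite /family_of (reindex (@enum_val J xpredT)); last first.
    by apply: onW_bij; exact: enum_val_bij.
  by apply: eq_bigr => k _; rewrite enum_valK -tnth_nth tnth_mktuple.
suff : basis_of U b by move/size_basis ->.
apply/andP; split; last first.
  apply/freeP => c; rewrite sumE => c0 k.
  rewrite -(enum_valK k) -(entry_family_of (fun t : J => c (enum_rank t))) c0.
  by rewrite /entry ffunE mxE.
rewrite eqEsubv; apply/andP; split.
  apply/span_subvP => _ /mapP[k _ ->]; apply/UP => t Pt.
  rewrite entry_unit_family; case: eqP => // tk.
  by rewrite tk (valP (enum_val k)) in Pt.
apply/subvP => W /UP /family_ofK ->; apply: rpred_sum => t _; apply: rpredZ.
apply: memv_span; apply/mapP; exists (enum_rank t); rewrite ?mem_enum //.
by rewrite enum_rankK.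
Qed.

End MatrixFamilies.

(** * Transport along words of arrows *)

Section Words.
Variables (K : fieldType) (Q : quiver) (n : nat).
Local Notation Rep := (Rep K Q n).
Implicit Types (W : Rep) (u : unipotent_group K Q n) (a b : arrow Q).
Implicit Types (v r : vertex Q) (w : seq (arrow Q * bool)).

Definition upper_rep W := forall a, upper (W a).
Definition unit_rep W := forall a, W a \in unitmx.

Lemma det_change_basis u W a : \det (change_basis u W a) = \det (W a).
Proof.
by rewrite ffunE !det_mulmx det_inv !det_unipotent invr1 mulr1 mul1r.
Qed.

(** The adjugate is the determinant times the inverse, and unipotent factors have determinant 1. *)
Lemma adj_conj (u u' : unipotent K n) (A : 'M[K]_n) : A \in unitmx ->
  \adj (u *m A *m invmx u') = u' *m \adj A *m invmx u.
Proof.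
move=> Au; set B := u *m A *m invmx u'.
have dB : \det B = \det A.
  by rewrite !det_mulmx det_inv !det_unipotent invr1 mulr1 mul1r.
have Bu : B \in unitmx by rewrite unitmxE dB -unitmxE.
apply: (can_inj (mulmxK Bu)); rewrite mul_adj_mx dB /B.
rewrite -!mulmxA (mulKmx (unipotent_unit u)) (mulmxA (\adj A)) mul_adj_mx.
by rewrite -scalar_mxC mulmxA mulmxV ?mul1mx // unipotent_unit.
Qed.

(** Parallel transport along [w], up to scalars: a letter travelled backwards contributes the
    adjugate rather than the inverse, which keeps the result polynomial in [W]. *)
Fixpoint word_mx W w : 'M[K]_n :=
  match w with
  | [::] => 1%:M
  | (a, true) :: w' => W a *m word_mx W w'
  | (a, false) :: w' => \adj (W a) *m word_mx W w'
  end.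

Lemma word_mx_unit W w : unit_rep W -> word_mx W w \in unitmx.
Proof.
move=> uW; elim: w => [|[a []] w IH] /=; rewrite ?unitmx1 // unitmx_mul IH andbT.
  exact: uW.
exact/unitmx_adj.
Qed.

Lemma upper_word_mx W w : unit_rep W -> upper_rep W -> upper (word_mx W w).
Proof.
move=> uW tW; elim: w => [|[a []] w IH] /=.
- exact/diag_upper/scalar_mx_is_diag.
- exact: upperM.
- by apply: upperM => //; exact: upper_adj.
Qed.

Lemma diag_word_mx W w : unit_rep W ->
  (forall a, a \in unzip1 w -> is_diag_mx (W a)) -> is_diag_mx (word_mx W w).
Proof.
move=> uW; elim: w => [|[a f] w IH] dW; first exact: scalar_mx_is_diag.
have da : is_diag_mx (W a) by apply: dW; rewrite inE eqxx.
have {IH} dw : is_diag_mx (word_mx W w).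
  by apply: IH => b bw; apply: dW; rewrite inE bw orbT.
by case: f {dW} => /=; apply: diagM => //; exact: diag_adj.
Qed.

Lemma eq_word_mx W W' w : (forall a, a \in unzip1 w -> W a = W' a) ->
  word_mx W w = word_mx W' w.
Proof.
elim: w => [|[a f] w IH] //= WW'; rewrite IH => [|b bw]; last first.
  by apply: WW'; rewrite inE bw orbT.
by rewrite WW' ?inE ?eqxx.
Qed.

Lemma word_mx1 W w : (forall a, a \in unzip1 w -> W a = 1%:M) ->
  word_mx W w = 1%:M.
Proof.
elim: w => [|[a f] w IH] //= W1; rewrite IH => [|b bw]; last first.
  by apply: W1; rewrite inE bw orbT.
by rewrite W1 ?inE ?eqxx // adj1; case: f {W1}; rewrite mul1mx.
Qed.

(** The unipotent factors at the intermediate vertices cancel in pairs. *)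
Lemma word_mx_change_basis u W r w v : unit_rep W -> zigzag r w v ->
  word_mx (change_basis u W) w = u v *m word_mx W w *m invmx (u r).
Proof.
move=> uW; elim: w v => [|[a []] w IH] v /=.
- by move=> /eqP->; rewrite mulmx1 mulmxV ?unipotent_unit.
- move=> /andP[/eqP<- /IH ->]; rewrite ffunE.
  by rewrite -!mulmxA (mulKmx (unipotent_unit (u (tail a)))).
- move=> /andP[/eqP<- /IH ->]; rewrite ffunE adj_conj //.
  by rewrite -!mulmxA (mulKmx (unipotent_unit (u (head a)))).
Qed.

Lemma polynomial_rep_mx a : polynomial_mx (fun W : Rep => W a).
Proof. by move=> i j; exact: (polynomial_entry K (a, (i, j))). Qed.

Lemma polynomial_word_mx w : polynomial_mx (word_mx^~ w : Rep -> _).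
Proof.
elim: w => [|[a f] w IH]; first exact: polynomial_mx_const.
case: f; apply: polynomial_mxM => //; first exact: polynomial_rep_mx.
by apply: polynomial_mx_adj; exact: polynomial_rep_mx.
Qed.

End Words.

(* For generic [W], the frames [N v W] form an isomorphism from a representation
   that is diagonal along [T] to [W]. *)
Lemma equivariant_frame (K : numFieldType) (Q : quiver) (n : nat) (a0 : arrow Q) :
  (forall i j, connect (adjacent_off a0) i j) ->
  exists (T : {set arrow Q}) (N : vertex Q -> Rep K Q n -> 'M[K]_n),
    [/\ #|T| = #|vertex Q|, forall v, polynomial_mx (N v),
        forall v W, upper_rep W -> unit_rep W -> upper (N v W) &
        forall u v W, upper_rep W -> unit_rep W ->
          N v (change_basis u W) = u v *m N v W] /\
    [/\ forall b (W : Rep K Q n), b \in T -> upper_rep W -> unit_rep W ->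
          exists2 D, is_diag_mx D &
            W b *m N (tail b) W = N (head b) W *m D,
        forall v (W : Rep K Q n), unit_rep W ->
          (forall b, b \in T -> is_diag_mx (W b)) -> is_diag_mx (N v W),
        forall v (W W' : Rep K Q n),
          (forall b, b \in T -> W b = W' b) -> N v W = N v W' &
        exists S : Rep K Q n, [/\ forall a, is_diag_mx (S a), unit_rep S &
                      forall v, N v S \in unitmx]].
Proof.
move=> Qc.
have [T [w [TQ a0T wz wT wE]]] := spanning_tree (tail a0) Qc.
pose M v (W : Rep K Q n) := word_mx W (w v).
(* Up to a scalar, the monodromy of the loop that leaves the root [tail a0], crosses [a0] and
   returns along the tree. *)
pose X W := \adj (M (head a0) W) *m W a0 *m M (tail a0) W.
pose N v W := M v W *m eigen_mx (X W).
have uX W : upper_rep W -> unit_rep W -> upper (X W).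
  move=> tW uW; rewrite !upperM ?upper_word_mx // upper_adj ?upper_word_mx //.
  exact: word_mx_unit.
(* The tree has one arrow fewer than there are vertices; [a0] makes up for it. *)
exists (a0 |: T)%SET, N; split; split.
- by rewrite cardsU1 a0T add1n.
- have Mp v : polynomial_mx (M v) by exact: polynomial_word_mx.
  move=> v; apply: polynomial_mxM => //; apply: polynomial_eigen_mx.
  apply: polynomial_mxM => //; apply: polynomial_mxM.
    exact: polynomial_mx_adj.
  exact: polynomial_rep_mx.
- by move=> v W tW uW; rewrite upperM ?upper_word_mx ?upper_eigen_mx ?uX.
- move=> u v W tW uW; rewrite /N.
  have ME x : M x (change_basis u W) = u x *m M x W *m invmx (u (tail a0)).
    exact: word_mx_change_basis.
  have -> : X (change_basis u W) = u (tail a0) *m X W *m invmx (u (tail a0)).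
    rewrite /X !ME adj_conj ?word_mx_unit // ffunE -!mulmxA.
    by rewrite !(mulKmx (unipotent_unit _)).
  by rewrite eigen_mx_conj ?uX // ME -!mulmxA (mulKmx (unipotent_unit _)).
- move=> b W bT tW uW; rewrite /N !mulmxA.
  case/setU1P: bT => [->|bT]; last first.
    (* Across a tree arrow the words differ by one letter, so the transports agree up to 1 or, if it
       is travelled backwards, up to [\det (W b)]. *)
    have [c Mc] : exists c, W b *m M (tail b) W = c *: M (head b) W.
      rewrite /M; have [->|->] := wE b bT; first by exists 1; rewrite scale1r.
      exists (\det (W b)).
      by rewrite /= mulmxA mul_mx_adj mul_scalar_mx.
    exists c%:M; first exact: scalar_mx_is_diag.
    by rewrite Mc -scalemxAl mul_mx_scalar.
  set H := M (head a0) W; have Hu : H \in unitmx by exact: word_mx_unit.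
  (* [H *m X W] is [\det H] times [W a0 *m M (tail a0) W], and [X W] acts diagonally on its
     eigenvectors. *)
  exists ((\det H)^-1 *: diag_mx (\row_j X W j j)).
    by rewrite -linearZ /= diag_mx_is_diag.
  rewrite -scalemxAr -[in RHS]mulmxA -eigen_mx_eigen ?uX // /X -/H !mulmxA.
  rewrite mul_mx_adj mul_scalar_mx -!scalemxAl scalerA mulVf ?scale1r //.
  by rewrite -unitfE -unitmxE.
- move=> v W uW dW.
  have dM x : is_diag_mx (M x W).
    by apply: diag_word_mx => // a /wT aT; apply: dW; rewrite inE aT orbT.
  apply: diagM => //; apply: diag_eigen_mx; apply: diagM => //.
  by apply: diagM; [rewrite diag_adj ?word_mx_unit | rewrite dW ?setU11].
- move=> v W W' WW'; have MM x : M x W = M x W'.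
    by apply: eq_word_mx => a /wT aT; apply: WW'; rewrite inE aT orbT.
  by rewrite /N /X !MM WW' ?setU11.
(* Trivial transports make the monodromy equal to [S a0], whose eigenvalues 1, ..., [n] are nonzero
   and distinct in characteristic 0. *)
- pose S : Rep K Q n :=
    [ffun a => if a == a0 then diag_mx (\row_i i.+1%:R) else 1%:M].
  have S1 x : M x S = 1%:M.
    apply: word_mx1 => a /wT aT; rewrite ffunE; case: eqP => // aa0.
    by rewrite -aa0 aT in a0T.
  have XS : X S = diag_mx (\row_i i.+1%:R).
    by rewrite /X !S1 adj1 mul1mx mulmx1 ffunE eqxx.
  exists S; split.
  + move=> a; rewrite ffunE.
    by case: ifP => _; rewrite ?diag_mx_is_diag ?scalar_mx_is_diag.
  + move=> a; rewrite ffunE; case: ifP => _; last exact: unitmx1.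
    rewrite unitmxE det_diag unitfE; apply/prodf_neq0 => i _.
    by rewrite mxE pnatr_eq0.
  + move=> v; rewrite /N S1 mul1mx XS; apply: eigen_mx_unit.
      exact/diag_upper/diag_mx_is_diag.
    move=> i j; rewrite !mxE !eqxx => /eqP.
    by rewrite eqr_nat eqSS => /eqP/val_inj.
Qed.

(** * The dimension counts *)

Section UnipotentRing.
Variables (K : numFieldType) (Q : quiver) (n : nat).
Local Notation lt_pair := (fun t : vertex Q * ('I_n * 'I_n) => (t.2.1 < t.2.2)%N).
Local Notation UG := (unipotent_group K Q n).
Local Notation Vv := {ffun vertex Q -> 'M[K]_n}.

(** The whole group is a chart: the identity plus arbitrary strictly upper triangular entries, with
    the flag taken through the identity. *)
Lemma dim_unipotent_coord_ring :
  dim_Spec (unipotent_coord_ring K Q n) #|{: {t | lt_pair t}}|.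
Proof.
pose one : Vv := [ffun=> 1%:M].
have tupleE u t : entry (@unipotent_tuple K Q n u) t = u t.1 t.2.1 t.2.2.
  by rewrite /entry ffunE.
apply: (@dim_Spec_chart K _ _ (@unipotent_tuple K Q n) _
  (fun u => coord_eval u : {rmorphism _ -> _}) _
  setT _ (fun t u => entry (unipotent_tuple u) (val t))
  one (fun t => unit_family K (val t)) _ _ (@coord_const _ _ _ _)
  _ _ (fun=> 0)) => //.
- exact: coord_eval_regular.
- move=> u _; rewrite -[LHS](subrKC one); congr (_ + _).
  rewrite [LHS](@family_ofK _ _ _ lt_pair).
    apply: eq_bigr => t _; congr (_ *: _); rewrite /entry !ffunE !mxE.
    by case: eqP => [tt|_]; rewrite ?subr0 //; have := valP t; rewrite /= tt ltnn.
  move=> t; rewrite -leqNgt => ji; rewrite /entry !ffunE !mxE.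
  have := ji; rewrite leq_eqVlt => /predU1P[/val_inj ->|lt].
    by rewrite unipotent_diag eqxx subrr.
  rewrite (upperP _ (upper_unipotent _)) //.
  by case: eqP => [tt|_]; rewrite ?subr0 //; rewrite tt ltnn in lt.
- move=> c; have /choice[u uE] v : exists u : unipotent K n,
      u = (one + family_of c) v :> 'M[K]_n.
    apply: unipotent_of => [|i]; last first.
      rewrite !ffunE mxE mxE eqxx -[X in _ + X]/(entry (family_of c) (v, (i, i))).
      by rewrite entry_family_of0 ?addr0 //= ltnn.
    apply/upperP => i j ji; rewrite !ffunE !mxE.
    rewrite -[X in _ + X]/(entry (family_of c) (v, (i, j))).
    rewrite entry_family_of0 ?addr0 -?leqNgt ?(ltnW ji) //.
    by case: eqP => // ij; rewrite ij ltnn in ji.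
  exists [ffun v => u v] => // t; rewrite tupleE ffunE uE !ffunE !mxE.
  rewrite -[X in _ + X]/(entry (family_of c) (val t)) entry_family_of.
  by case: eqP => [tt|_]; rewrite ?add0r //; have := valP t; rewrite /= tt ltnn.
- by move=> f f0; apply: coord_eval_inj => u; rewrite f0 // rmorph0.
- move=> t.
  exists (polynomial_coord _ (polynomial_entry K (val t))) => [u _ <-|] //.
  move=> u _ /= ut _; rewrite -[X in X != _]/(entry (unipotent_tuple u) (val t)).
  by rewrite ut add0r oner_eq0.
Qed.

End UnipotentRing.

(** * The filtered representation space as triangular families *)

Section FilteredRepresentations.
Variables (K : numFieldType) (Q : quiver) (n : nat).
Local Notation Rep := (Rep K Q n).
Local Notation FRep := (filtered_repType K Q n).
Local Notation rep x := (vsval (x : FRep) : Rep).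

Definition le_pair (t : arrow Q * ('I_n * 'I_n)) := (t.2.1 <= t.2.2)%N.

Lemma filtered_repP (W : Rep) : reflect (upper_rep W) (W \in filtered_rep K Q n).
Proof.
apply: (iffP (mem_filtered_rep W)) => [WF a|uW a j v jn /mem_std_flag v0].
  apply/upperP => i j ji.
  (* Basis vectors are numbered from 0, so vector [j] first lies in step [j.+1] of the flag. *)
  have jF : (delta_mx j 0 : 'cV[K]_n) \in std_flag K n j.+1.
    apply/mem_std_flag => k jk; rewrite mxE; case: eqP => // kj.
    by rewrite kj ltnn in jk.
  have /mem_std_flag/(_ i ji) := WF a j.+1 _ (ltn_ord j) jF.
  by rewrite -colE mxE.
apply/mem_std_flag => i ji; rewrite mxE big1 // => k _.
have [ki|ik] := ltnP k i; first by rewrite (upperP _ (uW a)) // mul0r.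
by rewrite v0 ?mulr0 // (leq_trans ji).
Qed.

Lemma filtered_upper (x : FRep) : upper_rep (rep x).
Proof. exact/filtered_repP/subvsP. Qed.

Lemma mem_filtered_repE (W : Rep) :
  W \in filtered_rep K Q n <-> forall t, ~~ le_pair t -> entry W t = 0.
Proof.
split=> [/filtered_repP uW t|W0].
  by rewrite /le_pair -ltnNge => ji; exact: (upperP _ (uW t.1)).
apply/filtered_repP => a; apply/upperP => i j ji.
by apply: (W0 (a, (i, j))); rewrite /le_pair -ltnNge.
Qed.

Lemma dim_filtered_rep : \dim (filtered_rep K Q n) = #|{: {t | le_pair t}}|.
Proof. exact/dim_family/mem_filtered_repE. Qed.

Lemma filtered_line_closed :
  line_closed (vsval : FRep -> Rep) setT.
Proof. by move=> x y _ _ z; exists (x + z *: (y - x)). Qed.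

Lemma change_basis1 (W : Rep) : change_basis (unipotent_group1 K Q n) W = W.
Proof.
by apply/ffunP => a; rewrite !ffunE /= invmx1 mulmx1 mul1mx.
Qed.

End FilteredRepresentations.

(** * The slice, and the dimension of the ring of invariants *)

Section Slice.
Variables (K : numFieldType) (Q : quiver) (n : nat).
Local Notation Rep := (Rep K Q n).
Local Notation FRep := (filtered_repType K Q n).
Local Notation rep x := (vsval (x : FRep) : Rep).
Local Notation A := (filtered_rep_invariants K Q n).
Variables (T : {set arrow Q}) (N : vertex Q -> Rep -> 'M[K]_n).
Hypothesis T_card : #|T| = #|vertex Q|.
Hypothesis N_poly : forall v, polynomial_mx (N v).
Hypothesis N_upper : forall v W, upper_rep W -> unit_rep W -> upper (N v W).
Hypothesis N_equivariant : forall u v W, upper_rep W -> unit_rep W ->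
  N v (change_basis u W) = u v *m N v W.
Hypothesis N_diag : forall b (W : Rep), b \in T -> upper_rep W -> unit_rep W ->
  exists2 D, is_diag_mx D & W b *m N (tail b) W = N (head b) W *m D.
Hypothesis N_slice : forall v W, unit_rep W ->
  (forall b, b \in T -> is_diag_mx (W b)) -> is_diag_mx (N v W).
Hypothesis N_local : forall v (W W' : Rep),
  (forall b, b \in T -> W b = W' b) -> N v W = N v W'.
Variable S : Rep.
Hypothesis S_diag : forall a, is_diag_mx (S a).
Hypothesis S_unit : unit_rep S.
Hypothesis N_S_unit : forall v, N v S \in unitmx.

Let S_upper : upper_rep S.
Proof. by move=> a; exact: diag_upper. Qed.

Let p : FRep := Subvs (introT (filtered_repP S) S_upper).

(** If [u] fixes [S], equivariance gives [u v *m N v S = N v S], and [N v S] cancels. *)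
Lemma stabilizer_slice : stabilizer p = [set unipotent_group1 K Q n].
Proof.
apply/seteqP; split=> u /=; last first.
  by move=> ->; apply/val_inj; rewrite /= change_basis1.
move=> /(congr1 vsval) /= uS; apply/ffunP => v; apply/val_inj.
rewrite ffunE /=; apply: (can_inj (mulmxK (N_S_unit v))).
by rewrite mul1mx -N_equivariant // uS.
Qed.

(** Its nonvanishing locus is where all arrows and all frames are invertible. *)
Definition generic_det (W : Rep) : K :=
  (\prod_a \det (W a)) * \prod_v \det (N v W).

Lemma generic_detP W : generic_det W != 0 ->
  unit_rep W /\ forall v, N v W \in unitmx.
Proof.
rewrite mulf_eq0 negb_or => /andP[/prodf_neq0 dW /prodf_neq0 dN].
by split=> [a|v]; rewrite unitmxE unitfE; [exact: dW | exact: dN].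
Qed.

Lemma generic_det_neq0 W : unit_rep W -> (forall v, N v W \in unitmx) ->
  generic_det W != 0.
Proof.
move=> uW uN; rewrite mulf_neq0 //; apply/prodf_neq0 => x _.
  by rewrite -unitfE -unitmxE.
by rewrite -unitfE -unitmxE.
Qed.

Lemma generic_det_poly : polynomial_function generic_det.
Proof.
apply: PolyMul; apply: polynomial_function_prod => x.
  exact/polynomial_function_det/polynomial_rep_mx.
exact: polynomial_function_det.
Qed.

Lemma generic_det_change_basis u W : upper_rep W ->
  generic_det (change_basis u W) = generic_det W.
Proof.
move=> tW; rewrite /generic_det.
under eq_bigr do rewrite det_change_basis.
(* Frames are only known to be equivariant where all arrows are invertible; elsewhere both sides are
   0. *)
have [->|dW] := eqVneq (\prod_a \det (W a)) 0; first by rewrite !mul0r.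
have uW : unit_rep W.
  by move=> a; rewrite unitmxE unitfE; apply: (prodf_neq0 _ _ dW).
congr (_ * _); apply: eq_bigr => v _.
by rewrite N_equivariant // det_mulmx det_unipotent mul1r.
Qed.

Definition slice : set FRep :=
  [set x | forall b, b \in T -> is_diag_mx (rep x b)].

(** The element [u v = D v *m invmx (N v W)] is unipotent because [D v] carries the diagonal of
    [N v W]. It turns the frames into the diagonal [D v], and the arrows of [T], diagonal in the
    frames, into diagonal matrices. *)
Lemma generic_to_slice (x : FRep) : generic_det (rep x) != 0 ->
  exists u, slice (filtered_action u x).
Proof.
move=> /generic_detP[uW uN]; have tW := filtered_upper x.
set W := rep x in uW uN tW *.
pose D v := diag_mx (\row_i N v W i i).
have /choice[u uE] v : exists u : unipotent K n,
    u = D v *m invmx (N v W) :> 'M[K]_n.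
  apply: unipotent_of => [|i].
    by rewrite upperM ?upper_inv ?N_upper //; exact/diag_upper/diag_mx_is_diag.
  rewrite mul_diag_mx !mxE -upperM_diag ?upper_inv ?N_upper //.
  by rewrite mulmxV // mxE eqxx.
have uN' v : u v *m N v W = D v by rewrite uE mulmxKV.
have Du v : D v \in unitmx.
  by rewrite -uN' unitmx_mul unipotent_unit uN.
exists [ffun v => u v] => b bT /=; rewrite !ffunE -/W.
have [E dE bE] := N_diag bT tW uW.
have -> : W b = N (head b) W *m E *m invmx (N (tail b) W).
  by rewrite -bE mulmxK.
have -> : u (head b) *m (N (head b) W *m E *m invmx (N (tail b) W)) *m
      invmx (u (tail b)) = D (head b) *m E *m invmx (D (tail b)).
  apply: (can_inj (mulmxK (Du (tail b)))); rewrite mulmxKV // -(uN' (tail b)).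
  by rewrite !mulmxA mulmxKV ?unipotent_unit // mulmxKV // uN'.
by apply: diagM; [apply: diagM => // | apply: diag_inv]; exact: diag_mx_is_diag.
Qed.

(** The product of [f] and [generic_det] vanishes everywhere, since generic points move into the
    slice. By irreducibility one factor vanishes, and [generic_det] does not at [S]. *)
Lemma slice_dense (f : A) :
  (forall x, slice x -> inv_eval x f = 0) -> f = 0.
Proof.
move=> f0; have [P Pp PE] := inv_eval_regular f.
have [x _|P0|G0] := line_closed_integral
  (@filtered_line_closed K Q n) Pp generic_det_poly.
- have [->|/generic_to_slice[u us]] := eqVneq (generic_det (rep x)) 0.
    by rewrite mulr0.
  by rewrite -PE -(inv_eval_action f u) f0 // mul0r.
- by apply: inv_eval_inj => x; rewrite PE P0 // rmorph0.
- have := G0 p I; move/eqP; rewrite (negbTE (generic_det_neq0 _ _)) //.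
Qed.

(** Indices of the free entries on the slice: arrows in [T] keep only their diagonal. *)
Definition slice_pair (t : arrow Q * ('I_n * 'I_n)) :=
  le_pair t && ((t.2.1 == t.2.2) || (t.1 \notin T)).

Lemma sliceE (x : FRep) : slice x <->
  forall t, ~~ slice_pair t -> entry (rep x) t = 0.
Proof.
split=> [xs [a [i j]]|x0 b bT].
  rewrite negb_and => /orP[ji|].
    exact: ((mem_filtered_repE (rep x)).1 (subvsP x) _ ji).
  rewrite negb_or negbK /= => /andP[ij aT]; exact: (is_diag_mxP (xs a aT)).
apply/is_diag_mxP => i j ij; apply: (x0 (b, (i, j))).
by rewrite negb_and negb_or bT (ij : i != j) orbT.
Qed.

(** The slice is a chart, and the flag goes through [S]. A diagonal entry minus its value at [S] is
    itself invariant; off the diagonal, [generic_det] times an entry of [F] restricts to the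
    coordinate up to a factor that is nonzero at the test point. *)
Lemma dim_filtered_rep_invariants :
  dim_Spec A #|{: {t | slice_pair t}}|.
Proof.
apply: (@dim_Spec_chart K _ _ (vsval : FRep -> Rep) _
  (fun x => inv_eval x : {rmorphism _ -> _}) _
  slice _ (fun t x => entry (rep x) (val t))
  0 (fun t => unit_family K (val t)) _ _ (@inv_const _ _ _ _ _ _)
  _ _ (fun t => entry S (val t))) => //.
- exact: inv_eval_regular.
- by move=> x /sliceE x0; rewrite add0r; exact: family_ofK.
- move=> c; have cF : family_of c \in filtered_rep K Q n.
    apply/mem_filtered_repE => t lt; apply: entry_family_of0.
    by rewrite negb_and lt.
  exists (Subvs cF) => [|t]; last exact: entry_family_of.
  by apply/sliceE => t; exact: entry_family_of0.
- exact: slice_dense.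
move=> [[b [i j]] tP] /=.
have [ij|ij] := eqVneq i j.
  rewrite -{j}ij in tP *.
  pose s := entry S (b, (i, i)).
  have Pp : polynomial_function (fun W : Rep => entry W (b, (i, i)) + (-1) * s).
    by apply: PolyAdd (polynomial_entry K _) _; exact: PolyConst.
  have PG u x : entry (vsval (@filtered_action K Q n u x)) (b, (i, i)) + (-1) * s
      = entry (rep x) (b, (i, i)) + (-1) * s.
    by rewrite {1}/entry ffunE conj_diag //; exact: filtered_upper.
  exists (InvariantRing (polynomial_invariant Pp PG)) => x xs /= xt.
    by rewrite /inv_eval /coord_eval /= xt mulN1r subrr.
  move=> _; rewrite /inv_eval /coord_eval /= xt mulN1r addrAC subrr add0r.
  exact: oner_neq0.
have bT : b \notin T by case/andP: tP => _; rewrite /= (negbTE ij).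
(* Up to a determinant this is [W b] written in the frames, so the changes of basis cancel. *)
pose F (W : Rep) := \adj (N (head b) W) *m W b *m N (tail b) W.
have Pp : polynomial_function (fun W : Rep => generic_det W * F W i j).
  apply: PolyMul; first exact: generic_det_poly.
  apply: polynomial_mxM => //; apply: polynomial_mxM.
    exact: polynomial_mx_adj.
  exact: polynomial_rep_mx.
have PG u x :
    generic_det (vsval (@filtered_action K Q n u x)) *
      F (vsval (filtered_action u x)) i j =
    generic_det (rep x) * F (rep x) i j.
  have tW := filtered_upper x; rewrite /= generic_det_change_basis //.
  have [->|/generic_detP[uW uN]] := eqVneq (generic_det (rep x)) 0.
    by rewrite !mul0r.
  rewrite /F !N_equivariant // ffunE.
  have := adj_conj (u (head b)) (unipotent1 K n) (uN (head b)).
  rewrite /= invmx1 mulmx1 mul1mx => ->; congr (_ * _).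
  by rewrite -!mulmxA !(mulKmx (unipotent_unit _)).
have FE x : slice x -> unit_rep (rep x) -> (forall v, N v (rep x) \in unitmx) ->
    F (rep x) i j = (\adj (N (head b) (rep x))) i i *
      entry (rep x) (b, (i, j)) * N (tail b) (rep x) j j.
  move=> xs uW uN; rewrite /F mulmx_diagr; last exact: N_slice.
  have /diag_mxP[d ->] : is_diag_mx (\adj (N (head b) (rep x))).
    by apply: diag_adj => //; exact: N_slice.
  by rewrite mul_diag_mx !mxE eqxx.
have S0 : entry S (b, (i, j)) = 0.
  exact: (is_diag_mxP (S_diag b)).
exists (InvariantRing (polynomial_invariant Pp PG)) => x xs; rewrite S0 => xt.
  rewrite /inv_eval /coord_eval /=.
  have [->|/generic_detP[uW uN]] := eqVneq (generic_det (rep x)) 0.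
    by rewrite mul0r.
  by rewrite FE // xt mulr0 mul0r mulr0.
move=> xS; rewrite /inv_eval /coord_eval /=.
(* As [i] differs from [j] and [b] lies outside [T], the test point agrees with [S] on all diagonals
   and on [T]. Hence it has the frames of [S] and the same nonzero determinants. *)
have xd a k : rep x a k k = S a k k.
  have tP' : slice_pair (a, (k, k)) by rewrite /slice_pair /le_pair leqnn eqxx.
  have := xS (exist _ (a, (k, k)) tP'); apply.
  by apply: contraNneq ij => -[_ -> ->].
have xT a : a \in T -> rep x a = S a.
  move=> aT; apply/matrixP => k l; have [->|kl] := eqVneq k l; first exact: xd.
  by rewrite (is_diag_mxP (xs a aT)) ?(is_diag_mxP (S_diag a)).
have NS v : N v (rep x) = N v S by exact: N_local.
have uW : unit_rep (rep x).
  move=> a; have := S_unit a; rewrite !unitmxE !det_upper //.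
    by under eq_bigr do rewrite -xd.
  exact: filtered_upper.
have uN v : N v (rep x) \in unitmx by rewrite NS.
have tN v : upper (N v (rep x)) by apply: N_upper => //; exact: filtered_upper.
rewrite mulf_neq0 ?generic_det_neq0 // FE // xt add0r mulr1.
rewrite mulf_neq0 ?upper_unit_diag //.
  by rewrite upper_adj.
by rewrite unitmx_adj.
Qed.

(** The slice loses exactly the strictly upper entries at the arrows of [T], and [T] has as many
    arrows as there are vertices. *)
Lemma slice_count : (#|{: {t | slice_pair t}}| +
  #|{: {t : vertex Q * ('I_n * 'I_n) | (t.2.1 < t.2.2)%N}}| =
  #|{: {t : arrow Q * ('I_n * 'I_n) | le_pair t}}|)%N.
Proof.
rewrite !card_sig -(cardID [pred t | slice_pair t] [pred t | le_pair t]).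
congr (_ + _)%N.
  by apply: eq_card => t; rewrite !inE /slice_pair andbA andbb.
pose lt := [pred q : 'I_n * 'I_n | (q.1 < q.2)%N].
transitivity (#|[predX T & lt]|).
  rewrite cardX T_card -[RHS]cardX; apply: eq_card => -[v q].
  by rewrite !inE.
apply: eq_card => -[a [i j]]; rewrite !inE /slice_pair /le_pair /=.
rewrite ltn_neqAle; case: leqP => _; rewrite ?andbF //.
by rewrite !andbT negb_or negbK andbC.
Qed.

End Slice.

Theorem theorem1p1 (R : realType) (Q : quiver) (n : nat) :
  connected_quiver Q ->
  has_loop Q \/
    (exists (i : vertex Q) (k : nat), (2 <= k)%N /\ local_path_kronecker i k) ->
  (exists p : filtered_repType R[i] Q n,
     stabilizer p = [set unipotent_group1 R[i] Q n]) /\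
  (exists d dU : nat,
     [/\ dim_Spec (filtered_rep_invariants R[i] Q n) d,
         dim_Spec (unipotent_coord_ring R[i] Q n) dU &
         d%:Z = (\dim (filtered_rep R[i] Q n))%:Z - dU%:Z]).
Proof.
move=> Qc /nonbridge_exists[a0 /(connected_off Qc) Qc0].
have [T [N [[TQ Np Nu Ne] [Nd Ns Nl [S [Sd Su NSu]]]]]] :=
  @equivariant_frame R[i] Q n a0 Qc0.
(* The point with trivial stabilizer is [S], read as a filtered representation. *)
split; first by eexists; exact: (stabilizer_slice Ne Sd Su NSu).
exists #|{: {t | slice_pair (n := n) T t}}|,
  #|{: {t : vertex Q * ('I_n * 'I_n) | (t.2.1 < t.2.2)%N}}|; split.
- exact: (dim_filtered_rep_invariants Np Nu Ne Nd Ns Nl Sd Su NSu).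
- exact: dim_unipotent_coord_ring.
- by rewrite dim_filtered_rep -(slice_count n TQ) PoszD addrK.
Qed.
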